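(* If $y>\exp(3.42\sqrt{\log x})$, then there exists a positive constant $c_2$ such that, as $x\to\infty$, $$ \frac1y\sum_{a\leq y}N_a(x)=\sum_{n\leq x}\frac{R(n)}{n}+O\!\left(x\exp(-c_2\sqrt{\log x})\right). $$
   Context: $a$ and $n$ run over positive integers. Carmichael's function $\lambda(n)$ is the exponent of the group $(\mathbb{Z}/n\mathbb{Z})^*$. For $a$ coprime to $n$, $\ell_a(n)$ is the multiplicative order of $a$ modulo $n$, and $a$ is called a $\lambda$-primitive root modulo $n$ if $\gcd(a,n)=1$ and $\ell_a(n)=\lambda(n)$. $R(n)=\#\{a\in(\mathbb{Z}/n\mathbb{Z})^*: a \text{ is a } \lambda\text{-primitive root modulo } n\}$ and $N_a(x)=\#\{n\leq x: a \text{ is a } \lambda\text{-primitive root modulo } n\}$. *)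

(* Defs.v *)
From HB Require Import structures.
From mathcomp Require Import all_boot all_order all_algebra.
From mathcomp Require Import all_classical all_reals all_analysis.
Set Implicit Arguments. Unset Strict Implicit. Unset Printing Implicit Defensive.

(* Multiplicative order of a modulo n (n >= 1, gcd(a,n)=1): the least k >= 1
   with a^k = 1 (mod n).  For such a, k <= phi(n) <= n, so searching
   k = 1..n suffices. *)
Definition ordmod (n a : nat) : nat :=
  (find (fun k => a ^ k.+1 %% n == 1 %% n) (iota 0 n)).+1.

Definition carmichael (n : nat) : nat :=
  \big[lcmn/1%N]_(b < n | coprime b n) ordmod n b.

Definition lprim (n a : nat) : bool :=
  coprime a n && (ordmod n a == carmichael n).

Definition Rcount (n : nat) : nat :=
  \sum_(b < n | lprim n b) 1.

Definition Ncount {R : realType} (a : nat) (x : R) : nat :=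
  \sum_(1 <= n < (Num.truncn x).+1 | lprim n a) 1.

(* Main.v *)
Require Import Defs.
From HB Require Import structures.
From mathcomp Require Import all_boot all_order all_fingroup all_algebra.
From mathcomp Require Import all_solvable all_field all_character.
From mathcomp Require Import all_classical all_reals all_analysis.
From mathcomp Require Import zify ring lra.
Set Implicit Arguments. Unset Strict Implicit. Unset Printing Implicit Defensive.
Import Order.TTheory GRing.Theory Num.Theory.
Local Open Scope ring_scope.

(** Summing over a first, the left-hand side counts, for each n <= x, the
    lambda-primitive roots a <= y.  The unit a is one iff no prime q dividing
    lambda(n) satisfies a^(lambda(n)/q) = 1, so inclusion-exclusion over such q
    reduces the count to subgroups of index at least d = q_1 ... q_j, which are
    detected by characters mod n.  Truncating at about u / ln u primes, where
    u = sqrt (ln x), costs exp(-cu) and leaves only exp(c'u) subgroups for every n.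

    It remains to show that, outside few n, all nonprincipal character sums over
    a <= y are at most y exp(-c''u).  The duality argument behind the large sieve,
    with the trivial bound for sums of the nonprincipal characters psi conj(psi'),
    is applied to the r-th power of the sum, y^r ~ F^3: the number of conductors
    f <= F carrying a large sum is controlled by the number of solutions of
    a_1 ... a_r = b_1 ... b_r in [1, y]^(2r).  Splitting off the part composed of
    bounded primes, and factoring the remaining parts as row and column products of
    a matrix, bounds this number by y^(r(1+eps)) exp(eps r^2), and r is at most
    about ln y because ln y > 3.42 u.  Hence at most sqrt F conductors f <= F are
    exceptional, and they are all larger than y exp(-c''u), so few n <= x have an
    exceptional divisor. *)

(** * Dirichlet characters *)

(** The exponent 3 in y^r ~ F^3 balances the large sieve: primitive characters of distinct
    conductors up to F correlate by at most F^2, there are at most F + 1 conductors, and the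
    off-diagonal total F^3 must not exceed the length y^r. The obstacle is the energy bound. The
    matrix has r^2 entries, so the weighted sum over one entry is raised to the power r^2; as r may
    be of the order of ln y, a constant factor well above 1 there would compete with y^r. Without
    the primes up to 2^J this sum is 1 + eps, since every rough number other than 1 exceeds 2^J,
    while each removed part takes at most a fixed power of ln y many values.

    Characters detecting subgroups need not be primitive. Passing to the conductor produces shorter
    sums, up to y/k, so the notion of exceptional conductor covers every k <= E; for larger k the
    trivial bound is enough.

    All gains and costs are exponentials in u: non-exceptional sums save E ~ exp(u/32), of which the
    truncated inclusion-exclusion spends exp(u/64) and the prime factors of n spend exp(u/100). *)

Record dchar (C : numClosedFieldType) (n : nat) (chi : nat -> C) : Prop := Dchar {
  dchar1 : chi 1%N = 1;
  dcharM : forall a b, chi (a * b)%N = chi a * chi b;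
  dchar_mod : forall a, chi (a %% n)%N = chi a;
  dchar_norm : forall a, coprime a n -> `|chi a| = 1;
  dchar0 : forall a, ~~ coprime a n -> chi a = 0 }.

(** No proper divisor of [f] is an induced modulus. At [f = 1] the condition is vacuous, which is
    why [1 < f] accompanies it below. *)
Definition primitive_char (C : numClosedFieldType) (f : nat) (psi : nat -> C) :=
  forall g, (g %| f)%N -> (g < f)%N ->
    exists a, [/\ coprime a f, a = 1 %[mod g] & psi a != 1].

Lemma coprime_eqmod (a b n : nat) : a = b %[mod n] -> coprime a n = coprime b n.
Proof. by move=> e; rewrite -(coprime_modl a) e coprime_modl. Qed.

Lemma eqmod_dvd (a b g n : nat) :
  (g %| n)%N -> a = b %[mod n] -> a = b %[mod g].
Proof. by move=> gn e; rewrite -(modn_dvdm a gn) e modn_dvdm. Qed.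

Lemma coprime_mul_modI (b n : nat) : coprime b n ->
  {in [pred a | (a < n)%N] &, injective (fun a => (b * a) %% n)%N}.
Proof.
move=> cb; suff le a a' : (a' < n)%N -> (a <= a')%N ->
    (b * a = b * a' %[mod n])%N -> a = a'.
  move=> a a'; rewrite !inE => la la' e.
  by case/orP: (leq_total a a') => h; [|apply/esym]; apply: le.
move=> la' laa e; apply/eqP; rewrite eqn_leq laa /= -subn_eq0.
have : (n %| b * a' - b * a)%N by rewrite -eqn_mod_dvd ?leq_mul2l ?laa ?orbT // e.
rewrite -mulnBr Gauss_dvdr 1?coprime_sym // => /dvdn_leq; lia.
Qed.

Lemma modn_inverse (b n : nat) : (0 < n)%N -> coprime b n ->
  exists c, (c * b = 1 %[mod n])%N.
Proof.
move=> n0 cb; exists (b ^ (totient n).-1)%N.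
by rewrite -expnSr prednK ?totient_gt0 // Euler_exp_totient.
Qed.

(** Each prime of [n] divides exactly one of the two summands: a prime of [a] divides neither [f]
    nor the part of [n] prime to [a], and any other prime of [n] divides that part. *)
Lemma coprime_lift (a f n : nat) : (0 < n)%N -> (0 < a)%N -> coprime a f ->
  coprime (a + f * n`_(\pi(a)^')) n.
Proof.
move=> n0 a0 caf; rewrite coprime_has_primes ?addn_gt0 ?a0 //.
apply/hasPn => p; rewrite !mem_primes => /and3P[pp _ pn].
rewrite /= addn_gt0 a0 pp /=.
case: (boolP (p %| a)%N) => pa.
  rewrite dvdn_addr // Euclid_dvdM // negb_or; apply/andP; split.
    apply/negP => pf; have : (p %| gcdn a f)%N by rewrite dvdn_gcd pa.
    by rewrite (eqP caf) dvdn1 => /eqP p1; rewrite p1 in pp.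
  apply/negP => pu; have := part_pnat (\pi(a)^') n.
  move/pnatP => /(_ (part_gt0 _ _) p pp pu).
  by rewrite !inE /= mem_primes pp a0 pa.
suff pu : (p %| n`_(\pi(a)^'))%N by rewrite dvdn_addl ?dvdn_mull // pa.
rewrite -(partnC (\pi(a)) n0) Euclid_dvdM // in pn.
case/orP: pn => // pu; have := part_pnat (\pi(a)) n.
move/pnatP => /(_ (part_gt0 _ _) p pp pu).
by rewrite !inE /= mem_primes pp a0 (negbTE pa).
Qed.

Lemma chinese_one (a f f' : nat) : (0 < a)%N -> (0 < f')%N ->
  a = 1 %[mod gcdn f f'] ->
  exists c, c = a %[mod f] /\ c = 1 %[mod f'].
Proof.
move=> a0 f'0 e; set g := gcdn f f' in e.
have /dvdnP[w ew] : (g %| a - 1)%N by rewrite -eqn_mod_dvd // e.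
have [t lt /dvdnP[v ev]] := Bezoutl f f'0.
rewrite gcdnC -/g in ev.
exists (a + f * (t * w))%N; split; first by rewrite addnC mulnC modnMDl.
have -> : (a + f * (t * w))%N = (w * v * f' + 1)%N.
  have -> : a = (w * g + 1)%N by lia.
  rewrite -mulnA -ev; ring.
by rewrite modnMDl.
Qed.

Section DcharTheory.
Variable C : numClosedFieldType.
Implicit Types chi psi : nat -> C.

Lemma dchar_eqmod n chi a b : dchar n chi -> a = b %[mod n] -> chi a = chi b.
Proof. by move=> h e; rewrite -(dchar_mod h a) e (dchar_mod h). Qed.

Lemma dchar_le1 n chi a : dchar n chi -> `|chi a| <= 1.
Proof.
move=> h; case: (boolP (coprime a n)) => c; first by rewrite (dchar_norm h).
by rewrite (dchar0 h) // normr0.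
Qed.

Lemma dchar_mul_conj n n' chi psi : dchar n chi -> dchar n' psi ->
  dchar (n * n') (fun a => chi a * (psi a)^*).
Proof.
move=> h h'; split.
- by rewrite (dchar1 h) (dchar1 h') rmorph1 mulr1.
- by move=> a b; rewrite (dcharM h) (dcharM h') rmorphM; ring.
- move=> a; congr (_ * _^*).
    by apply: dchar_eqmod h _; rewrite modn_dvdm // dvdn_mulr.
  by apply: dchar_eqmod h' _; rewrite modn_dvdm // dvdn_mull.
- move=> a; rewrite coprimeMr => /andP[c c'].
  by rewrite normrM norm_conjC (dchar_norm h) // (dchar_norm h') // mulr1.
- move=> a; rewrite coprimeMr negb_and => /orP[c|c].
    by rewrite (dchar0 h) // mul0r.
  by rewrite (dchar0 h') // rmorph0 mulr0.
Qed.

Lemma dchar_sum0 n chi b : (0 < n)%N -> dchar n chi -> coprime b n ->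
  chi b != 1 -> \sum_(0 <= a < n) chi a = 0.
Proof.
move=> n0 h cb nb.
rewrite big_mkord; set S := (X in X = 0).
pose k (a : 'I_n) : 'I_n := Ordinal (ltn_pmod (b * a) n0).
have kI : injective k.
  by move=> a a' /(congr1 val) /= /(coprime_mul_modI cb) e; apply/val_inj/e; rewrite inE.
have : S = chi b * S.
  rewrite {1}/S (reindex k) /=; last by apply: onW_bij; apply: injF_bij.
  rewrite mulr_sumr; apply: eq_bigr => a _.
  by rewrite (dchar_mod h) (dcharM h).
move/eqP; rewrite -subr_eq0 -{1}(mul1r S) -mulrBl mulf_eq0 subr_eq0 eq_sym.
by rewrite (negbTE nb) => /eqP.
Qed.

Lemma norm_sum_dchar_le n chi (m M : nat) : dchar n chi ->
  `|\sum_(m <= a < M) chi a| <= (M - m)%:R.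
Proof.
move=> h; apply: le_trans (ler_norm_sum _ _ _) _.
apply: le_trans (ler_sum _ (fun a _ => dchar_le1 a h)) _.
by rewrite big_const_nat iter_addr addr0.
Qed.

Lemma dchar_sum_le n chi b (M : nat) : (0 < n)%N -> dchar n chi ->
  coprime b n -> chi b != 1 -> `|\sum_(0 <= a < M) chi a| <= n%:R.
Proof.
move=> n0 h cb nb; elim/ltn_ind: M => M IH.
case: (leqP M n) => le.
  by apply: le_trans (norm_sum_dchar_le _ _ h) _; rewrite ler_nat subn0.
rewrite (@big_cat_nat _ _ _ n) 1?ltnW //= (dchar_sum0 n0 h cb nb) add0r.
rewrite -{1}(add0n n) big_addn.
rewrite (eq_bigr chi); first by apply: IH; lia.
by move=> a _; apply: dchar_eqmod h _; rewrite modnDr.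
Qed.

Lemma primitive_nonprincipal f psi : (1 < f)%N -> primitive_char f psi ->
  exists2 a, coprime a f & psi a != 1.
Proof.
by move=> f1 /(_ 1%N (dvd1n _) f1)[a [ca _ na]]; exists a.
Qed.

Lemma primitive_sum_le f psi t : (1 < f)%N -> dchar f psi -> primitive_char f psi ->
  `|\sum_(1 <= a < t.+1) psi a| <= f%:R.
Proof.
move=> f1 h p; have [b cb nb] := primitive_nonprincipal f1 p.
have := dchar_sum_le t.+1 (ltnW f1) h cb nb.
by rewrite big_ltn // (dchar0 h) ?add0r // /coprime gcd0n; lia.
Qed.

(** If gcd(f, f') < f, primitivity gives a unit a = 1 modulo the gcd with psi(a) <> 1, and a number
    congruent to a mod f and to 1 mod f' separates the characters. Otherwise f divides f' properly
    and the roles are exchanged. *)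
Lemma primitive_separated f f' psi psi' : (1 < f)%N -> (1 < f')%N ->
  dchar f psi -> dchar f' psi' -> primitive_char f psi -> primitive_char f' psi' ->
  f <> f' -> exists2 c, coprime c (f * f') & psi c != psi' c.
Proof.
move=> f1 f1' h h' p p'.
have half g g' (xi xi' : nat -> C) : (1 < g)%N -> (1 < g')%N -> dchar g xi -> dchar g' xi' ->
    primitive_char g xi -> (gcdn g g' < g)%N ->
    exists2 c, coprime c (g * g') & xi c != xi' c.
  move=> g1 g1' k k' q lt.
  have [a [ca ea na]] := q _ (dvdn_gcdl _ _) lt.
  have a0 : (0 < a)%N by case: a ca {ea na} => //; rewrite /coprime gcd0n; lia.
  have [c [e e']] := chinese_one a0 (ltnW g1') ea.
  exists c; first by rewrite coprimeMr (coprime_eqmod e) ca (coprime_eqmod e') coprime1n.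
  by rewrite (dchar_eqmod k e) (dchar_eqmod k' e') (dchar1 k').
move=> ne; case: (ltnP (gcdn f f') f) => lt; first exact: half lt.
have lt' : (gcdn f' f < f')%N.
  have : (gcdn f f' <= f')%N by rewrite dvdn_leq ?dvdn_gcdr //; lia.
  have : (gcdn f f' <= f)%N by rewrite dvdn_leq ?dvdn_gcdl //; lia.
  by rewrite (gcdnC f' f); move: lt ne; lia.
have [c cc nc] := half _ _ psi' psi f1' f1 h' h p' lt'.
by exists c; rewrite 1?mulnC // eq_sym.
Qed.

Lemma primitive_correlation_le f f' psi psi' M : (1 < f)%N -> (1 < f')%N ->
  dchar f psi -> dchar f' psi' -> primitive_char f psi -> primitive_char f' psi' ->
  f <> f' -> `|\sum_(0 <= m < M) psi m * (psi' m)^*| <= (f * f')%:R.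
Proof.
move=> f1 f1' h h' p p' ne.
have [c cc nc] := primitive_separated f1 f1' h h' p p' ne.
apply: (dchar_sum_le (b := c)) => //; first by rewrite muln_gt0; lia.
  exact: dchar_mul_conj.
apply: contraNneq nc => e; have := cc; rewrite coprimeMr => /andP[_ c'].
apply/eqP; rewrite -[LHS]mulr1 -(expr1n _ 2) -(dchar_norm h' c') normCK.
by rewrite mulrCA e mulr1.
Qed.

(** Take the least divisor f of [n] such that [chi] is 1 on all units congruent to 1 mod f. Then
    [chi] on units depends only on the residue mod f, and psi(a) is its value at a lift of a to a
    unit mod [n]. Minimality of f is primitivity. *)
Lemma exists_primitive n chi b : (0 < n)%N -> dchar n chi ->
  coprime b n -> chi b != 1 ->
  exists f psi, [/\ (f %| n)%N, (1 < f)%N, dchar f psi, primitive_char f psi &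
    forall a, coprime a n -> psi a = chi a].
Proof.
move=> n0 h cb nb.
pose P f := (f %| n)%N && [forall a : 'I_n,
  coprime a n && (a == 1 %[mod f]) ==> (chi a == 1)].
have PE f : (f %| n)%N -> reflect
    (forall a, coprime a n -> a = 1 %[mod f] -> chi a = 1) (P f).
  move=> fn; rewrite /P fn /=; apply: (iffP forallP) => H a.
    move=> ca ea; have := H (Ordinal (ltn_pmod a n0)) => /=.
    rewrite coprime_modl ca (modn_dvdm a fn) ea eqxx /= (dchar_mod h).
    by move/eqP.
  by apply/implyP => /andP[ca /eqP ea]; rewrite H.
have exP : exists f, P f.
  exists n; apply/PE => // a ca ea; rewrite -(dchar1 h).
  exact: dchar_eqmod h ea.
case: (ex_minnP exP) => f Pf fmin.
have fn : (f %| n)%N by case/andP: Pf.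
have f0 : (0 < f)%N by rewrite (dvdn_gt0 n0).
have triv := elimT (PE f fn) Pf.
have f1 : (1 < f)%N.
  rewrite ltn_neqAle f0 andbT; apply/eqP => e; rewrite -e in triv.
  by move: nb; rewrite triv ?eqxx // !modn1.
have wd c c' : coprime c n -> coprime c' n -> c = c' %[mod f] -> chi c = chi c'.
  move=> cc cc' e; have [d ed] := modn_inverse n0 cc'.
  have ed' := eqmod_dvd fn ed.
  have cd : coprime d n.
    have : coprime (d * c') n by rewrite (coprime_eqmod ed) coprime1n.
    by rewrite coprimeMl => /andP[].
  have e1 : chi (d * c)%N = 1.
    apply: triv; first by rewrite coprimeMl cd.
    by rewrite -modnMmr e modnMmr.
  have e2 : chi (d * c')%N = 1 by apply: triv; rewrite // coprimeMl cd.
  have nd : chi d != 0 by rewrite -normr_eq0 (dchar_norm h cd) oner_eq0.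
  by apply: (mulfI nd); rewrite -!(dcharM h) e1 e2.
pose bb a := (a + f * n`_(\pi(a)^'))%N.
have bbf a : bb a = a %[mod f] by rewrite /bb addnC mulnC modnMDl.
have bbn a : coprime a f -> coprime (bb a) n.
  move=> ca; apply: coprime_lift => //.
  by case: a ca => //; rewrite /coprime gcd0n; lia.
pose psi a := if coprime a f then chi (bb a) else 0.
have psiE a : coprime a n -> psi a = chi a.
  move=> ca; have caf := coprime_dvdr fn ca.
  by rewrite /psi caf; apply: wd; rewrite ?bbn.
have psich a c : coprime c n -> c = a %[mod f] -> psi a = chi c.
  move=> cc e; have caf : coprime a f.
    by rewrite -(coprime_eqmod e) (coprime_dvdr fn).
  by rewrite /psi caf; apply: wd; rewrite ?bbn // bbf.
exists f, psi; split => //.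
  split.
  - by rewrite psiE ?coprime1n // (dchar1 h).
  - move=> a c; case: (boolP (coprime (a * c) f)) => cac.
      have := cac; rewrite coprimeMl => /andP[ca cc].
      rewrite (psich _ (bb a * bb c)%N) ?coprimeMl ?bbn //.
        by rewrite (dcharM h) /psi ca cc.
      by rewrite -modnMm !bbf modnMm.
    rewrite /psi (negbTE cac); move: cac; rewrite coprimeMl negb_and.
    by case/orP => /negbTE ->; rewrite ?mul0r ?mulr0.
  - move=> a; rewrite /psi coprime_modl; case: (boolP (coprime a f)) => // ca.
    by apply: wd; rewrite ?bbn ?coprime_modl // !bbf modn_mod.
  - by move=> a ca; rewrite /psi ca (dchar_norm h) // bbn.
  - by move=> a ca; rewrite /psi (negbTE ca).
move=> g gf lt; have gn := dvdn_trans gf fn.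
have nP : ~~ P g by apply/negP => /fmin; lia.
move: nP; rewrite /P gn /= => /forallPn[a]; rewrite negb_imply.
case/andP => /andP[ca /eqP ea] na.
by exists a; split; rewrite ?psiE ?(coprime_dvdr fn).
Qed.

End DcharTheory.

(** * A large sieve inequality by duality *)

Section LargeSieve.
Variables (C : numClosedFieldType) (I : finType) (P : pred I) (M B : nat).
Variables (chi : I -> nat -> C) (a : nat -> C).
Hypothesis chi_le1 : forall i, P i -> forall m, `|chi i m| <= 1.
Hypothesis chi_corr : forall i j, P i -> P j -> i != j ->
  `|\sum_(0 <= m < M) chi i m * (chi j m)^*| <= B%:R.

Let A i := \sum_(0 <= m < M) a m * chi i m.
Let c m := \sum_(i | P i) A i * (chi i m)^*.
Let Z := \sum_(i | P i) `|A i| ^+ 2.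
Let N := (M + B * #|P|)%N.

Let sum_a_conj_c : \sum_(0 <= m < M) a m * (c m)^* = Z.
Proof.
under eq_bigr do rewrite /c rmorph_sum mulr_sumr.
rewrite exchange_big /=; apply: eq_bigr => i _.
rewrite normCK {1}/A mulr_suml; apply: eq_bigr => m _.
by rewrite rmorphM /= conjCK; ring.
Qed.

(** Schur's test for the Gram matrix of the characters: after 2 |A_i A_j| <= |A_i|^2 + |A_j|^2, only
    the row sums of the majorant [w] matter, and each equals [N]. *)
Let sum_norm_c : \sum_(0 <= m < M) `|c m| ^+ 2 <= N%:R * Z.
Proof.
have eqc : \sum_(0 <= m < M) `|c m| ^+ 2 = \sum_(i | P i) \sum_(j | P j)
    A i * (A j)^* * \sum_(0 <= m < M) chi j m * (chi i m)^*.
  under eq_bigr do rewrite normCK /c rmorph_sum mulr_suml.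
  rewrite exchange_big /=; apply: eq_bigr => i _.
  under eq_bigr do rewrite mulr_sumr.
  rewrite exchange_big /=; apply: eq_bigr => j _.
  rewrite mulr_sumr; apply: eq_bigr => m _.
  by rewrite rmorphM /= conjCK; ring.
have ge0 : 0 <= \sum_(0 <= m < M) `|c m| ^+ 2.
  by apply: sumr_ge0 => m _; rewrite exprn_ge0.
rewrite -(ger0_norm ge0) eqc.
pose w (i j : I) : C := (if i == j then M%:R else 0) + B%:R.
have term i j : P i -> P j ->
    `|A i * (A j)^* * \sum_(0 <= m < M) chi j m * (chi i m)^*|
    <= 2^-1 * (`|A i| ^+ 2 + `|A j| ^+ 2) * w i j.
  move=> Pi Pj; rewrite !normrM norm_conjC; apply: ler_pM => //.
  - rewrite ler_pdivlMl // -subr_ge0.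
    have -> : `|A i| ^+ 2 + `|A j| ^+ 2 - 2 * (`|A i| * `|A j|) = (`|A i| - `|A j|) ^+ 2 by ring.
    by rewrite real_exprn_even_ge0 // rpredB ?normr_real.
  - rewrite /w; case: eqVneq => [->|ne]; last first.
      by rewrite add0r; apply: chi_corr => //; rewrite eq_sym.
    rewrite -[leLHS]addr0 lerD // ?ler0n //; apply: le_trans (ler_norm_sum _ _ _) _.
    apply: (@le_trans _ _ (\sum_(0 <= m < M) 1)).
      apply: ler_sum => m _; rewrite normrM norm_conjC.
      by rewrite -[leRHS](mulr1 1) ler_pM ?chi_le1.
    by rewrite big_const_nat iter_addr addr0 subn0.
apply: le_trans (ler_norm_sum _ _ _) _.
apply: le_trans (ler_sum _ (fun i _ => ler_norm_sum _ _ _)) _.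
apply: (@le_trans _ _ (\sum_(i | P i) \sum_(j | P j)
   2^-1 * (`|A i| ^+ 2 + `|A j| ^+ 2) * w i j)).
  by apply: ler_sum => i Pi; apply: ler_sum => j Pj; exact: term.
have sym : \sum_(i | P i) \sum_(j | P j) `|A i| ^+ 2 * w i j = N%:R * Z.
  rewrite /Z mulr_sumr; apply: eq_bigr => i Pi.
  rewrite -mulr_sumr mulrC; congr (_ * _).
  rewrite /w big_split /= (bigD1 i) //= eqxx big1 ?addr0; last first.
    by move=> j /andP[_ /negbTE]; rewrite eq_sym => ->.
  by rewrite sumr_const /N natrD natrM mulr_natr.
have sym' : \sum_(i | P i) \sum_(j | P j) `|A j| ^+ 2 * w i j = N%:R * Z.
  rewrite -sym exchange_big /=; apply: eq_bigr => i _; apply: eq_bigr => j _.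
  by rewrite /w eq_sym.
rewrite le_eqVlt; apply/orP; left; apply/eqP.
transitivity (2^-1 * (N%:R * Z + N%:R * Z)); last first.
  by rewrite -mulr2n -[X in _ * X]mulr_natl mulKf ?pnatr_eq0.
rewrite -{1}sym -sym' -big_split /= mulr_sumr; apply: eq_bigr => i _.
rewrite -big_split /= mulr_sumr; apply: eq_bigr => j _; ring.
Qed.

(** With <a, c> = Z and |c|^2 <= N Z, expanding 0 <= |N a - c|^2 leaves N Z <= N^2 |a|^2. *)
Lemma large_sieve :
  \sum_(i | P i) `|\sum_(0 <= m < M) a m * chi i m| ^+ 2
  <= (M + B * #|P|)%:R * \sum_(0 <= m < M) `|a m| ^+ 2.
Proof.
rewrite -/A -/Z -/N; case: (posnP M) => [M0|Mp].
  rewrite /Z /A M0 big_geq // mulr0 big1 // => i _.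
  by rewrite big_geq // normr0 expr0n.
have Np : 0 < N%:R :> C by rewrite ltr0n /N addn_gt0 Mp.
set W := \sum_(0 <= m < M) `|a m| ^+ 2.
have ZR : Z^* = Z.
  by rewrite /Z rmorph_sum; apply: eq_bigr => i _; rewrite rmorphXn /= conj_normC.
have : 0 <= \sum_(0 <= m < M) `|N%:R * a m - c m| ^+ 2.
  by apply: sumr_ge0 => m _; rewrite exprn_ge0.
have -> : \sum_(0 <= m < M) `|N%:R * a m - c m| ^+ 2
   = N%:R ^+ 2 * W - N%:R * Z - N%:R * Z + \sum_(0 <= m < M) `|c m| ^+ 2.
  rewrite -{2}ZR -sum_a_conj_c /W rmorph_sum !mulr_sumr -!sumrN -!big_split /=.
  apply: eq_bigr => m _; rewrite !normCK rmorphB !rmorphM /= ?conjCK conjC_nat; ring.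
move=> h; have := le_trans h (lerD (lexx _) sum_norm_c).
rewrite addrNK expr2 -mulrA -mulrBr pmulr_rge0 // subr_ge0.
by [].
Qed.

End LargeSieve.

(** * Exceptional conductors *)

(** The multiplicative energy of order r of the integers 1, ..., t; ['I_t] starts at 0, hence the
    successors. *)
Definition nsol (t r : nat) : nat :=
  #|[set fg : {ffun 'I_r -> 'I_t} * {ffun 'I_r -> 'I_t} |
     (\prod_i (fg.1 i).+1 == \prod_i (fg.2 i).+1)%N]|.

(** The lengths [Y %/ k] are those met when a character mod n is replaced by the primitive one
    inducing it: sieving out primes shortens the sum by integer factors. *)
Definition exceptional (Y E f : nat) : Prop :=
  (1 < f)%N /\ exists k, (0 < k <= E)%N /\ exists psi : nat -> algC,
    [/\ dchar f psi, primitive_char f psi &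
        Y%:R <= E%:R * `|\sum_(1 <= a < (Y %/ k).+1) psi a|].

Lemma exceptional_ge Y E f : exceptional Y E f -> (Y <= E * f)%N.
Proof.
move=> [f1 [k [_ [psi [h p le]]]]].
rewrite -(ler_nat algC) natrM; apply: le_trans le _.
by rewrite ler_wpM2l ?ler0n // primitive_sum_le.
Qed.

Lemma prod_succ_le (t r Y : nat) (f : {ffun 'I_r -> 'I_t}) : (t <= Y)%N ->
  (\prod_i (f i).+1 <= Y ^ r)%N.
Proof.
move=> tY; rewrite -[X in (_ <= _ ^ X)%N]card_ord -prod_nat_const.
by apply: leq_prod => i _; apply: leq_trans tY.
Qed.

Lemma dchar_prod (C : numClosedFieldType) n (chi : nat -> C) (I : finType) (F : I -> nat) :
  dchar n chi -> chi (\prod_i F i)%N = \prod_i chi (F i).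
Proof.
by move=> h; apply: (big_morph chi (dcharM h) (dchar1 h)).
Qed.

(** Raising to the power r gives a character sum of length Y^r, weighted by numbers of
    factorisations. This length is what makes the large sieve effective for conductors far above
    Y. *)
Lemma power_sum_dchar (C : numClosedFieldType) n (chi : nat -> C) t r Y :
  (t <= Y)%N -> dchar n chi ->
  (\sum_(1 <= a < t.+1) chi a) ^+ r = \sum_(0 <= m < (Y ^ r).+1)
    #|[set f : {ffun 'I_r -> 'I_t} | (\prod_i (f i).+1 == m)%N]|%:R * chi m.
Proof.
move=> tY h; rewrite big_add1 /= big_mkord.
rewrite -[X in _ ^+ X]card_ord -prodr_const bigA_distr_bigA /=.
pose p (f : {ffun 'I_r -> 'I_t}) : 'I_(Y ^ r).+1 :=
  Ordinal (prod_succ_le f tY : (_ < _.+1)%N).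
rewrite (partition_big p predT) //= big_mkord; apply: eq_bigr => m _.
rewrite (eq_bigr (fun=> chi m)); last first.
  by move=> f /eqP <-; rewrite -(dchar_prod _ h).
rewrite sumr_const mulr_natl; congr (_ *+ _); apply: eq_card => f.
by rewrite inE unfold_in.
Qed.

Lemma nsolE (t r Y : nat) : (t <= Y)%N ->
  (\sum_(0 <= m < (Y ^ r).+1)
     #|[set f : {ffun 'I_r -> 'I_t} | (\prod_i (f i).+1 == m)%N]| ^ 2 = nsol t r)%N.
Proof.
move=> tY; rewrite /nsol -sum1_card big_mkord.
under [RHS]eq_bigl do rewrite inE.
rewrite -(pair_big_dep xpredT (fun f g : {ffun 'I_r -> 'I_t} =>
   \prod_i (f i).+1 == \prod_i (g i).+1)%N (fun _ _ => 1%N)) /=.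
pose p (f : {ffun 'I_r -> 'I_t}) : 'I_(Y ^ r).+1 :=
  Ordinal (prod_succ_le f tY : (_ < _.+1)%N).
rewrite [RHS](partition_big p predT) //=; apply: eq_bigr => m _.
rewrite -mulnn -{1}sum1_card big_distrl /=; apply: eq_big => f.
  by rewrite !inE -val_eqE.
rewrite inE => /eqP e; rewrite mul1n -sum1_card; apply: eq_bigl => g.
by rewrite inE e eq_sym.
Qed.

(** For fixed k each conductor contributes at least (Y/E)^(2r) to the large sieve for r-th powers,
    whose right-hand side is the energy times the length. Summing over k <= E costs the last factor
    E. *)
Lemma exceptional_count (Y E F r Q : nat) : (0 < Y)%N -> (0 < F)%N ->
  (F ^ 3 <= Y ^ r)%N -> (forall t, (t <= Y)%N -> (nsol t r <= Q)%N) ->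
  (#|[set f : 'I_F.+1 | `[< exceptional Y E f >]]| * Y ^ r
     <= 4 * E ^ (2 * r).+1 * Q)%N.
Proof.
move=> Y0 F0 FY hQ.
pose ex k f (psi : nat -> algC) := [/\ dchar f psi, primitive_char f psi &
        Y%:R <= E%:R * `|\sum_(1 <= a < (Y %/ k).+1) psi a|].
pose T k := [set f : 'I_F.+1 | (1 < f)%N && `[< exists psi, ex k f psi >]].
have Tk k : (#|T k| * Y ^ r <= 4 * E ^ (2 * r) * Q)%N.
  (* One character per conductor suffices, since conductors are counted; distinct conductors then
     make every product psi conj(psi') nonprincipal. *)
  have [psi hpsi] : exists psi : 'I_F.+1 -> nat -> algC,
      forall f, (f \in T k) -> ex k f (psi f).
    suff /boolp.choice[psi h] : forall f : 'I_F.+1, exists psi, f \in T k -> ex k f psi.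
      by exists psi.
    move=> f; case: (boolP (f \in T k)) => [|_]; last by exists (fun=> 0).
    by rewrite inE => /andP[_ /asboolP[psi h]]; exists psi.
  have T1 f : f \in T k -> (1 < f)%N by rewrite inE => /andP[].
  pose t := (Y %/ k)%N; have tY : (t <= Y)%N by exact: leq_div.
  pose a m : algC := #|[set f : {ffun 'I_r -> 'I_t} | (\prod_i (f i).+1 == m)%N]|%:R.
  have LS := @large_sieve algC _ (mem (T k)) (Y ^ r).+1 (F ^ 2) psi a.
  have /LS {}LS : forall i, i \in T k -> forall m, `|psi i m| <= 1.
    by move=> f /hpsi [h _ _] m; exact: dchar_le1 h.
  have /LS {}LS : forall i j, i \in T k -> j \in T k -> i != j ->
      `|\sum_(0 <= m < (Y ^ r).+1) psi i m * (psi j m)^*| <= (F ^ 2)%:R.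
    move=> i j ti tj ne; have [h p _] := hpsi _ ti; have [h' p' _] := hpsi _ tj.
    apply: le_trans (primitive_correlation_le _ (T1 _ ti) (T1 _ tj) h h' p p' _) _.
      by move=> e; case/eqP: ne; apply: val_inj.
    by rewrite ler_nat -mulnn leq_mul // -ltnS.
  (* The extra factor Y^r cancels against the large sieve constant, which is at most (Y^r + 1) + 2
     F^3 <= 4 Y^r. *)
  rewrite -(leq_pmul2r (m := Y ^ r)) ?expn_gt0 ?Y0 //.
  rewrite -(ler_nat algC).
  have lower : (#|T k| * Y ^ r * Y ^ r)%:R <= (E ^ (2 * r))%:R *
      \sum_(i in T k) `|\sum_(0 <= m < (Y ^ r).+1) a m * psi i m| ^+ 2.
    rewrite -mulnA natrM mulr_natl mulr_sumr -sumr_const.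
    apply: ler_sum => f tf; have [h p le] := hpsi _ tf.
    rewrite -(power_sum_dchar r tY h) normrX -exprM (mulnC r) !natrX -exprMn.
    rewrite -expnD addnn -mul2n natrX.
    by rewrite lerXn2r ?nnegrE ?mulr_ge0 ?ler0n.
  apply: le_trans lower _.
  apply: le_trans (ler_wpM2l (ler0n _ _) LS) _.
  have -> : \sum_(0 <= m < (Y ^ r).+1) `|a m| ^+ 2 = (nsol t r)%:R.
    rewrite -(nsolE r tY) natr_sum; apply: eq_bigr => m _.
    by rewrite normr_nat natrX.
  rewrite -!natrM ler_nat.
  apply: (@leq_trans (E ^ (2 * r) * (4 * Y ^ r * Q))%N); last by apply: eq_leq; ring.
  rewrite leq_mul // leq_mul ?hQ //.
  have c : (#|T k| <= F.+1)%N by rewrite -[X in (_ <= X)%N](card_ord F.+1) max_card.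
  have Yr : (0 < Y ^ r)%N by rewrite expn_gt0 Y0.
  have : (F ^ 2 * #|T k| <= 2 * F ^ 3)%N.
    apply: leq_trans (leq_mul (leqnn _) c) _.
    have : (F ^ 2 <= F * F ^ 2)%N by rewrite leq_pmull.
    by rewrite (expnS F 2) mulnS (mulnC (F ^ 2)%N F) mul2n -addnn leq_add2r.
  move=> le; apply: (@leq_trans ((Y ^ r).+1 + 2 * F ^ 3)%N).
    by rewrite leq_add2l.
  by move: FY Yr; move: (F ^ 3)%N (Y ^ r)%N => p q; lia.
have cov : (#|[set f : 'I_F.+1 | `[< exceptional Y E f >]]| <=
    \sum_(1 <= k < E.+1) #|T k|)%N.
  rewrite -sum1_card.
  apply: (@leq_trans (\sum_(f : 'I_F.+1) \sum_(1 <= k < E.+1) (f \in T k))).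
    rewrite big_mkcond /=; apply: leq_sum => f _; case: ifP => //.
    rewrite inE => /asboolP[f1 [k [/andP[k0 kE] [psi h]]]].
    rewrite (bigD1_seq k) ?iota_uniq ?mem_index_iota ?k0 ?ltnS //=.
    rewrite inE f1 /=; case: asboolP => // -[].
    by exists psi.
  rewrite exchange_big /=; apply: leq_sum => k _.
  by rewrite -sum1_card [leqRHS]big_mkcond /=; apply: leq_sum => f _; case: ifP.
apply: leq_trans (leq_mul cov (leqnn _)) _.
rewrite big_distrl /=; apply: leq_trans (leq_sum _ (fun k _ => Tk k)) _.
by rewrite sum_nat_const_nat subSS subn0 expnS; apply: eq_leq; ring.
Qed.

(** * Multiplicative energy of an interval *)

(** Greedy choice: take g = gcd(a, b_r) for the last factor; a/g is coprime to b_r/g, hence divides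
    the product of the others. *)
Lemma dvd_prod_split (r a : nat) (b : nat -> nat) : (0 < a)%N ->
  (a %| \prod_(0 <= j < r) b j)%N ->
  exists d : nat -> nat, (forall j, (j < r)%N -> (d j %| b j)%N) /\
    (\prod_(0 <= j < r) d j = a)%N.
Proof.
elim: r a => [|r IH] a a0.
  by rewrite big_geq // dvdn1 => /eqP ->; exists (fun=> 1%N); rewrite big_geq.
rewrite big_nat_recr //= => h; pose g := gcdn a (b r).
have g0 : (0 < g)%N by rewrite gcdn_gt0 a0.
have [] := IH (a %/ g)%N.
- by rewrite divn_gt0 // dvdn_leq // dvdn_gcdl.
- have [e|bp] := posnP (b r).
    by rewrite /g e gcdn0 divnn a0 dvd1n.
  have : coprime (a %/ g) (b r %/ g).
    rewrite /coprime -(eqn_pmul2r g0) mul1n muln_gcdl !divnK ?dvdn_gcdl ?dvdn_gcdr //.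
  move=> cop; rewrite -(Gauss_dvdl _ cop) -(dvdn_pmul2r g0) divnK ?dvdn_gcdl //.
  by rewrite -mulnA divnK ?dvdn_gcdr.
move=> d [dd pd]; exists (fun j => if j == r then g else d j); split.
  move=> j; rewrite ltnS; case: eqP => [-> _|ne le]; first exact: dvdn_gcdr.
  by apply: dd; lia.
rewrite big_nat_recr //= eqxx -[RHS](divnK (dvdn_gcdl a (b r))) -/g -pd.
congr (_ * _)%N; apply: eq_big_nat => j /andP[_ lt]; case: eqP => //; lia.
Qed.

(** Induction on the rows: the last a_r divides the product of the b_j, so it splits into divisors
    d_j of b_j. They form its row, and the columns b_j / d_j remain for the other rows. *)
Lemma prod_matrix_split (r s : nat) (a b : nat -> nat) :
  (forall i, (0 < a i)%N) -> (forall j, (0 < b j)%N) ->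
  (\prod_(0 <= i < r) a i = \prod_(0 <= j < s) b j)%N ->
  exists D : nat -> nat -> nat,
    (forall i, (i < r)%N -> (\prod_(0 <= j < s) D i j = a i)%N) /\
    (forall j, (j < s)%N -> (\prod_(0 <= i < r) D i j = b j)%N).
Proof.
elim: r b => [|r IH] b a0 b0.
  rewrite big_geq // => /esym/eqP h; exists (fun _ _ => 1%N); split => // j js.
  rewrite big_geq //; have : (b j %| \prod_(0 <= j < s) b j)%N.
    by rewrite (bigD1_seq j) ?iota_uniq ?mem_index_iota //= dvdn_mulr.
  by rewrite (eqP h) dvdn1 => /eqP.
rewrite big_nat_recr //= => e.
have [d [dd pd]] : exists d : nat -> nat, (forall j, (j < s)%N -> (d j %| b j)%N) /\
    (\prod_(0 <= j < s) d j = a r)%N.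
  by apply: dvd_prod_split; rewrite // -e dvdn_mull.
(* The value 1 outside the range keeps [b'] positive everywhere, as the induction hypothesis
   demands. *)
pose b' j := (if j < s then b j %/ d j else 1)%N.
have [] := IH b' a0.
- move=> j; rewrite /b'; case: ifP => // js; have dj := dd j js.
  by rewrite divn_gt0 ?(dvdn_gt0 (b0 j) dj) // (dvdn_leq (b0 j) dj).
- apply/eqP; rewrite -(eqn_pmul2r (a0 r)) e -pd -big_split /=; apply/eqP.
  by apply: eq_big_nat => j /andP[_ js]; rewrite /b' js divnK ?dd.
move=> D [Dr Dc]; exists (fun i j => if i == r then d j else D i j); split.
  move=> i; rewrite ltnS; case: eqP => [-> _ //|ne le]; apply: Dr; lia.
move=> j js; rewrite big_nat_recr //= eqxx.
rewrite (eq_big_nat _ _ (F2 := fun i => D i j)); last first.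
  by move=> i /andP[_ lt]; case: eqP => //; lia.
by rewrite Dc // /b' js divnK ?dd.
Qed.

Definition small_primes (J : nat) : nat_pred := [pred p | p <= 2 ^ J]%N.

Section Energy.
Variables (J r t' : nat).
Let t := t'.+1.
Let l := trunc_log 2 t.
Let V := 'I_t.
Let pi := small_primes J.
Let smooth : {set V} := [set v : V | pi.-nat v.+1].
Let rough : {set V} := [set v : V | pi^'.-nat v.+1].
Let enc (n : nat) : V := inord n.-1.

Let encK n : (0 < n <= t)%N -> (enc n).+1 = n.
Proof. by case/andP => n0 nt; rewrite /enc inordK ?prednK //; lia. Qed.

Let encI n n' : (0 < n <= t)%N -> (0 < n' <= t)%N -> enc n = enc n' -> n = n'.
Proof. by move=> h h' e; rewrite -(encK h) e encK. Qed.

Let partl q (v : V) : (0 < v.+1`_q <= t)%N.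
Proof.
rewrite part_gt0 /=; apply: (@leq_trans v.+1); last exact: ltn_ord.
by rewrite dvdn_leq // dvdn_part.
Qed.

(** A smooth number is determined by its exponents at the p <= 2^J, each of them at most log_2 t. *)
Let card_smooth : (#|smooth| <= l.+1 ^ (2 ^ J).+1)%N.
Proof.
pose h (v : V) : {ffun 'I_(2 ^ J).+1 -> 'I_l.+1} :=
  [ffun p : 'I_(2 ^ J).+1 => inord (logn p v.+1)].
have logle p (v : V) : (logn p v.+1 < l.+1)%N.
  rewrite ltnS; have [pp|/negbTE np] := boolP (prime p); last by rewrite lognE np.
  apply: trunc_log_max => //; apply: (@leq_trans (p ^ logn p v.+1)%N).
    by case: (logn p v.+1) => // k; rewrite leq_exp2r // prime_gt1.
  by apply: leq_trans (ltn_ord v); rewrite dvdn_leq // pfactor_dvdnn.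
have hI : {in smooth &, injective h}.
  move=> v v'; rewrite !inE => sv sv' e; apply: val_inj => /=; apply: succn_inj.
  apply: eqn_from_log => // p; case: (leqP p (2 ^ J)) => pJ.
    have := congr1 (fun F : {ffun _ -> _} => val (F (Ordinal (pJ : p < (2 ^ J).+1)%N))) e.
    by rewrite !ffunE /= !inordK.
  have z (w : V) : pi.-nat w.+1 -> logn p w.+1 = 0%N.
    move=> sw; rewrite lognE; case: ifP => // /and3P[pp _ pd].
    have := pnatP _ _ sw; move=> /(_ isT p pp pd); rewrite inE; lia.
  by rewrite !z.
rewrite -(card_in_imset hI); apply: leq_trans (max_card _) _.
by rewrite card_ffun !card_ord.
Qed.

Let rsol : {set {ffun 'I_r -> V} * {ffun 'I_r -> V}} :=
  [set fg | (fg.1 \in ffun_on (mem rough)) && (fg.2 \in ffun_on (mem rough)) &&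
     (\prod_i (fg.1 i).+1 == \prod_i (fg.2 i).+1)%N].

Let part_prod q (f : {ffun 'I_r -> V}) :
  ((\prod_i (f i).+1)`_q = \prod_i (f i).+1`_q)%N.
Proof.
have : (0 < \prod_i (f i).+1)%N /\ ((\prod_i (f i).+1)`_q = \prod_i (f i).+1`_q)%N.
  elim/big_rec2: _ => [|i y x _ [x0 e]]; first by rewrite partn1.
  by rewrite muln_gt0 x0 /= partnM // e.
by case.
Qed.

(** Taking rough parts is multiplicative, so they still solve the product equation; the equation
    between the 2r smooth parts is simply forgotten. *)
Let nsol_split : (nsol t r <= #|smooth| ^ (2 * r) * #|rsol|)%N.
Proof.
pose pt q (f : {ffun 'I_r -> V}) : {ffun 'I_r -> V} :=
  [ffun i => enc ((f i).+1`_q)].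
pose h (fg : {ffun 'I_r -> V} * {ffun 'I_r -> V}) :=
  ((pt pi fg.1, pt pi fg.2), (pt pi^' fg.1, pt pi^' fg.2)).
have ptI f f' : pt pi f = pt pi f' -> pt pi^' f = pt pi^' f' -> f = f'.
  move=> e e'; apply/ffunP => i; apply: val_inj => /=; apply: succn_inj.
  have := congr1 (fun F : {ffun _ -> _} => F i) e.
  have := congr1 (fun F : {ffun _ -> _} => F i) e'.
  rewrite !ffunE => /encI k /encI k'.
  rewrite -(partnC pi (ltn0Sn (f i))) -(partnC pi (ltn0Sn (f' i))).
  by rewrite k // k'.
have hI : injective h.
  by move=> [f g] [f' g'] [e1 e2 e3 e4]; rewrite (ptI f f') // (ptI g g').
rewrite /nsol -(card_imset _ hI).
pose A := [set f : {ffun 'I_r -> V} | f \in ffun_on (mem smooth)].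
have -> : (#|smooth| ^ (2 * r) * #|rsol| = #|finset.setX (finset.setX A A) rsol|)%N.
  have cA : #|A| = (#|smooth| ^ r)%N.
    by rewrite [LHS]cardsE card_ffun_on card_ord.
  by rewrite !cardsX cA mul2n -addnn expnD.
apply/subset_leq_card/fintype.subsetP => _ /imsetP[[f g] + ->]; rewrite inE /= => /eqP e.
have inA k : pt pi k \in A.
  by rewrite inE; apply/ffun_onP => i; rewrite ffunE inE encK ?partl // part_pnat.
have inB k : pt pi^' k \in ffun_on (mem rough).
  by apply/ffun_onP => i; rewrite ffunE inE encK ?partl // part_pnat.
rewrite !finset.in_setX /= !inA inE /= !inB /=.
have pe k : (\prod_i (pt pi^' k i).+1 = (\prod_i (k i).+1)`_pi^')%N.
  by rewrite part_prod; apply: eq_bigr => i _; rewrite ffunE encK ?partl.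
by rewrite !pe e.
Qed.

Let row : {set {ffun 'I_r -> V}} :=
  [set e | (e \in ffun_on (mem rough)) && (\prod_i (e i).+1 <= t)%N].

(** Writing both sides as row and column products of an r by r matrix, the rows alone recover the
    solution, and each row is a rough tuple whose product is at most t. *)
Let card_rsol : (#|rsol| <= #|row| ^ r)%N.
Proof.
pose X := [set x : {ffun 'I_r -> {ffun 'I_r -> V}} | x \in ffun_on (mem row)].
have -> : (#|row| ^ r = #|X|)%N by rewrite [RHS]cardsE card_ffun_on card_ord.
pose phi (x : {ffun 'I_r -> {ffun 'I_r -> V}}) : {ffun 'I_r -> V} * {ffun 'I_r -> V} :=
  ([ffun i => enc (\prod_j (x i j).+1)%N], [ffun j => enc (\prod_i (x i j).+1)%N]).
apply: leq_trans (leq_imset_card phi X).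
apply/subset_leq_card/fintype.subsetP => -[f g]; rewrite inE /= => /andP[/andP[rf rg] /eqP e].
(* The extensions are 1 beyond ['I_r], so that they are positive at every index. *)
pose nf i := oapp (fun i : 'I_r => (f i).+1) 1%N (insub i).
pose ng i := oapp (fun i : 'I_r => (g i).+1) 1%N (insub i).
have nfE (i : 'I_r) : nf i = (f i).+1 by rewrite /nf valK.
have ngE (i : 'I_r) : ng i = (g i).+1 by rewrite /ng valK.
have [||| D [Dr Dc]] := @prod_matrix_split r r nf ng.
- by move=> i; rewrite /nf; case: insub.
- by move=> i; rewrite /ng; case: insub.
- rewrite !big_mkord; under eq_bigr do rewrite nfE.
  by rewrite e; apply: eq_bigr => i _; rewrite ngE.
have Dd (i j : 'I_r) : (D i j %| (f i).+1)%N.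
  by rewrite -nfE -Dr // big_mkord (bigD1 j) //= dvdn_mulr.
have Dl (i j : 'I_r) : (0 < D i j <= t)%N.
  rewrite (dvdn_gt0 _ (Dd i j)) //=; apply: leq_trans (ltn_ord (f i)).
  by rewrite dvdn_leq.
pose x : {ffun 'I_r -> {ffun 'I_r -> V}} := [ffun i : 'I_r => [ffun j : 'I_r => enc (D i j)]].
have xE (i j : 'I_r) : (x i j).+1 = D i j by rewrite !ffunE encK.
have xr i : (\prod_j (x i j).+1 = (f i).+1)%N.
  by rewrite -nfE -Dr // big_mkord; apply: eq_bigr => j _; rewrite xE.
have xc j : (\prod_i (x i j).+1 = (g j).+1)%N.
  by rewrite -ngE -Dc // big_mkord; apply: eq_bigr => i _; rewrite xE.
have encS (v : V) : enc v.+1 = v by rewrite /enc inord_val.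
apply/imsetP; exists x; last first.
  by congr (_, _); apply/ffunP => i; rewrite ffunE ?xr ?xc encS.
rewrite inE; apply/ffun_onP => i; rewrite inE xr ltn_ord andbT.
apply/ffun_onP => j; rewrite inE xE; apply: (pnat_dvd (Dd i j)).
by have /ffun_onP/(_ i) := rf; rewrite inE.
Qed.

Variables (R : realFieldType) (s : R).
Hypotheses (s0 : 0 < s) (s1 : s < 1).
(** Rankin's weight: [q ^+ trunc_log 2 n] replaces n^(-sigma) with sigma = 1 + log_2(1/s), just
    above 1 when s is close to 1, and uses integer powers only. *)
Let q : R := s / 2.

(** The block [2^j, 2^(j+1)) has 2^j terms of weight (s/2)^j, so it contributes s^j. *)
Let dyadic_sum m : \sum_(0 <= n < 2 ^ m | (2 ^ J <= n)%N) q ^+ trunc_log 2 n =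
  \sum_(0 <= j < m | (J <= j)%N) s ^+ j.
Proof.
elim: m => [|m IH].
  rewrite [RHS]big_geq // big_mkcond big_nat1 /=.
  by rewrite leqNgt expn_gt0.
rewrite (@big_cat_nat _ _ _ (2 ^ m)%N) ?leq_exp2l //= IH.
rewrite [RHS]big_mkcond big_nat_recr //= -big_mkcond; congr (_ + _).
have -> : \sum_(2 ^ m <= n < 2 ^ m.+1 | (2 ^ J <= n)%N) q ^+ trunc_log 2 n =
   \sum_(2 ^ m <= n < 2 ^ m.+1) (if (J <= m)%N then q ^+ m else 0).
  rewrite big_mkcond; apply: eq_big_nat => n h.
  rewrite (@trunc_log_eq 2 m n) //; case: (leqP J m) => c.
    by rewrite (leq_trans _ (proj1 (andP h))) ?leq_exp2l.
  rewrite leqNgt (leq_trans (proj2 (andP h))) ?leq_exp2l //.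
rewrite big_const_nat iter_addr addr0 expnS mul2n -addnn addnK.
case: ifP => _; last by rewrite mul0rn.
by rewrite -mulr_natl natrX -exprMn /q mulrC divfK ?pnatr_eq0.
Qed.

Let dyadic_sum_le m :
  \sum_(0 <= n < 2 ^ m | (2 ^ J <= n)%N) q ^+ trunc_log 2 n <= s ^+ J / (1 - s).
Proof.
rewrite dyadic_sum ler_pdivlMr ?subr_gt0 //.
case: (leqP m J) => c.
  rewrite big_nat_cond big_pred0 ?mul0r ?exprn_ge0 ?ltW //.
  by move=> j; lia.
have -> : \sum_(0 <= j < m | (J <= j)%N) s ^+ j = \sum_(J <= j < m) s ^+ j.
  rewrite (@big_cat_nat _ _ _ J) //= 1?ltnW // big_nat_cond big_pred0 ?add0r; last first.
    by move=> j; lia.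
  by rewrite big_nat_cond [RHS]big_nat; apply: eq_bigl => j; lia.
rewrite mulr_suml.
rewrite (eq_bigr (fun j => - (s ^+ j.+1) - (- (s ^+ j)))).
  by rewrite telescope_sumr 1?ltnW // opprK addrC gerBl exprn_ge0 // ltW.
by move=> j _; rewrite exprS; ring.
Qed.

Let q0 : 0 < q. Proof. by rewrite divr_gt0. Qed.
Let q1 : q <= 1.
Proof. by rewrite ler_pdivrMr ?ltr0n // mul1r (le_trans (ltW s1)) // ler1n. Qed.

(** The number 1 contributes 1; any other rough number has all its primes above 2^J, so it lies in
    the tail of the dyadic sum. *)
Let sum_rough : \sum_(v in rough) q ^+ trunc_log 2 v.+1 <= 1 + s ^+ J / (1 - s).
Proof.
rewrite (bigID (fun v : V => v == ord0)) /=; apply: lerD.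
  rewrite (bigD1 ord0) /=; last by rewrite inE eqxx andbT.
  rewrite trunc_log1 expr0 big1 ?addr0 // => v /andP[/andP[_ ->]]; by [].
apply: le_trans (dyadic_sum_le l.+1).
rewrite (eq_bigl (fun v : V => (pi^'.-nat v.+1) && (v != 0 :> nat))); last by move=> v; rewrite inE.
rewrite -(big_mkord (fun v => (pi^'.-nat v.+1) && (v != 0)%N) (fun v => q ^+ trunc_log 2 v.+1)).
rewrite -(big_add1 _ _ 0 t.+1 (fun n => pi^'.-nat n && (n.-1 != 0)%N) (fun n => q ^+ trunc_log 2 n)).
have lt : (t.+1 <= 2 ^ l.+1)%N by apply: trunc_log_ltn.
rewrite [leRHS](@big_cat_nat _ _ _ t.+1) //=.
rewrite -[leLHS]addr0; apply: lerD; last by apply: sumr_ge0 => n _; rewrite exprn_ge0 // ltW.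
rewrite [leRHS]big_mkcond [leRHS]big_ltn //=.
rewrite -[leLHS]add0r; apply: lerD; first by case: ifP => // _; rewrite exprn_ge0 // ltW.
rewrite big_mkcond; apply: ler_sum_nat => n /andP[n0 nt].
case: ifP => [/andP[rn n1]|_]; last by case: ifP => // _; rewrite exprn_ge0 // ltW.
rewrite (_ : (2 ^ J <= n)%N) //.
have n2 : (1 < n)%N by lia.
have := pnatP _ n0 rn; move=> /(_ _ (pdiv_prime n2) (pdiv_dvd n)).
rewrite !inE -ltnNge => /ltnW h; apply: leq_trans h _; exact: pdiv_leq.
Qed.

(** The logarithms of the entries of a row, rounded down, add up to at most l, so each row has
    weight at least q^l; the total weight is the r-th power of the sum over rough numbers. *)
Let card_row : #|row|%:R <= (2 / s) ^+ l * (1 + s ^+ J / (1 - s)) ^+ r.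
Proof.
have q'0 : 0 < q^-1 by rewrite invr_gt0.
have -> : 2 / s = q^-1 by rewrite /q invf_div.
apply: (@le_trans _ _ (q^-1 ^+ l * (\sum_(v in rough) q ^+ trunc_log 2 v.+1) ^+ r)); last first.
  rewrite ler_wpM2l ?exprn_ge0 ?(ltW q'0) // lerXn2r ?nnegrE ?sum_rough //.
    by apply: sumr_ge0 => v _; rewrite exprn_ge0 // ltW.
  by apply: addr_ge0 => //; apply: divr_ge0; rewrite ?exprn_ge0 ?subr_ge0 ?(ltW s0) ?(ltW s1).
rewrite -[X in _ * _ ^+ X](card_ord r) -prodr_const.
under eq_bigr do rewrite big_mkcond.
rewrite bigA_distr_bigA /= mulr_sumr -sumr_const.
rewrite big_mkcond /=; apply: ler_sum => e _.
set P := \prod_i _; have P0 : 0 <= P.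
  by apply: prodr_ge0 => i _; case: ifP => // _; rewrite exprn_ge0 // ltW.
case: ifP => [|_]; last by rewrite mulr_ge0 // exprn_ge0 // ltW.
rewrite inE => /andP[/ffun_onP re le].
have -> : P = q ^+ (\sum_i trunc_log 2 (e i).+1)%N.
  by rewrite /P -prodrXr; apply: eq_bigr => i _; rewrite re.
rewrite exprVn ler_pdivlMl ?exprn_gt0 // mulr1.
apply: ler_wiXn2l; rewrite ?(ltW q0) //; apply: trunc_log_max => //.
apply: leq_trans le; rewrite expn_sum; apply: leq_prod => i _; exact: trunc_logP.
Qed.

Lemma nsol_le_succ : (nsol t r)%:R <=
  ((l.+1 ^ (2 ^ J).+1) ^ (2 * r))%:R * ((2 / s) ^+ l * (1 + s ^+ J / (1 - s)) ^+ r) ^+ r.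
Proof.
apply: (@le_trans _ _ (#|smooth| ^ (2 * r) * #|row| ^ r)%:R).
  rewrite ler_nat; apply: leq_trans nsol_split _; exact: leq_mul card_rsol.
rewrite natrM; apply: ler_pM; rewrite ?ler0n //.
  by rewrite ler_nat; case: (2 * r)%N => // k; rewrite leq_exp2r.
by rewrite natrX lerXn2r ?nnegrE ?ler0n // (le_trans _ card_row) ?ler0n.
Qed.
End Energy.

(** The bound depends on [Y] alone, because [exceptional_count] asks for it at every length t <=
    Y. *)
Lemma nsol_le (R : realFieldType) (s : R) (J r t Y : nat) : 0 < s -> s < 1 ->
  (t <= Y)%N -> (nsol t r)%:R <=
  (((trunc_log 2 Y).+1 ^ (2 ^ J).+1) ^ (2 * r))%:R *
    ((2 / s) ^+ trunc_log 2 Y * (1 + s ^+ J / (1 - s)) ^+ r) ^+ r.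
Proof.
move=> s0 s1 tY.
have d0 : 0 <= s ^+ J / (1 - s).
  by apply: divr_ge0; rewrite ?exprn_ge0 ?subr_ge0 ?(ltW s0) ?(ltW s1).
have q1 : 1 <= 2 / s by rewrite ler_pdivlMr // mul1r; lra.
have D1 : 1 <= (1 + s ^+ J / (1 - s)) ^+ r by rewrite exprn_ege1 // lerDl.
case: t tY => [_|t tY].
  apply: (@le_trans _ _ 1).
    rewrite -[1]/(1%:R) ler_nat /nsol; apply: leq_trans (max_card _) _.
    by rewrite card_prod !card_ffun !card_ord; case: (r) => // k; rewrite exp0n.
  have h1 : 1 <= ((2 / s) ^+ trunc_log 2 Y * (1 + s ^+ J / (1 - s)) ^+ r) ^+ r.
    by apply/exprn_ege1/mulr_ege1 => //; exact: exprn_ege1.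
  by apply: mulr_ege1 => //; rewrite ler1n !expn_gt0.
apply: le_trans (nsol_le_succ J r t s0 s1) _.
have tl : (trunc_log 2 t.+1 <= trunc_log 2 Y)%N by exact: leq_trunc_log.
have q0 := le_trans ler01 q1.
apply: ler_pM; rewrite ?ler0n ?exprn_ge0 ?mulr_ge0 ?exprn_ge0 ?addr_ge0 //.
  rewrite ler_nat -!expnM.
  by case: (_ * _)%N => // k; rewrite leq_exp2r.
rewrite lerXn2r ?nnegrE ?mulr_ge0 ?exprn_ge0 ?addr_ge0 //.
rewrite ler_wpM2r ?exprn_ge0 ?addr_ge0 //.
exact: ler_weXn2l.
Qed.

(** * Sieving by the prime divisors of the modulus *)

Lemma sum_multiples (R : zmodType) (p t : nat) (F : nat -> R) : (0 < p)%N ->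
  \sum_(1 <= a < t.+1 | (p %| a)%N) F a = \sum_(1 <= b < (t %/ p).+1) F (p * b)%N.
Proof.
move=> p0; elim: t => [|t IH]; first by rewrite div0n !big_geq.
rewrite big_mkcond big_nat_recr //= -big_mkcond IH divnS //.
case: ifP => [/dvdnP[m e]|_]; last by rewrite addr0.
rewrite add1n [RHS]big_nat_recr //=; congr (_ + F _).
have -> : (t %/ p).+1 = (t.+1 %/ p)%N by rewrite divnS // e dvdn_mull.
by rewrite e mulnK // mulnC.
Qed.

Definition sifted_sum (R : pzRingType) (psi : nat -> R) (s : seq nat) (t : nat) : R :=
  \sum_(1 <= a < t.+1 | all (fun p => ~~ (p %| a)%N) s) psi a.

Lemma sifted_sum_cons (R : pzRingType) (psi : nat -> R) p s t :
  (forall a b, psi (a * b)%N = psi a * psi b) ->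
  prime p -> all prime s -> p \notin s ->
  sifted_sum psi (p :: s) t = sifted_sum psi s t - psi p * sifted_sum psi s (t %/ p).
Proof.
move=> psiM pp /allP ps pns.
have -> : sifted_sum psi s t = sifted_sum psi (p :: s) t +
    \sum_(1 <= a < t.+1 | (p %| a)%N)
      (if all (fun q => ~~ (q %| a)%N) s then psi a else 0).
  rewrite /sifted_sum (bigID (fun a => p %| a)%N) /= addrC; congr (_ + _).
    by apply: eq_bigl => a; rewrite andbC.
  by rewrite -big_mkcondr; apply: eq_bigl => a; rewrite andbC.
rewrite sum_multiples ?prime_gt0 // /sifted_sum mulr_sumr big_mkcond.
rewrite [X in _ = _ + _ - X]big_mkcond.
rewrite [X in _ = _ + X - _](eq_bigr (fun b => if all (fun q => ~~ (q %| b)%N) s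
   then psi p * psi b else 0)) ?addrK // => b _.
rewrite psiM; congr (if _ then _ else _); apply: eq_in_all => q qs.
have pq := ps q qs; rewrite Euclid_dvdM // dvdn_prime2 //.
suff -> : (q == p) = false by [].
by apply: contraNF pns => /eqP <-.
Qed.

(** Every prime doubles the number of sums, and successive floor divisions compose, so only lengths
    [Y %/ k] occur. *)
Lemma sifted_sum_le (C : numDomainType) (psi : nat -> C) (Y : nat) (W : C) s :
  (forall a b, psi (a * b)%N = psi a * psi b) -> (forall a, `|psi a| <= 1) ->
  (forall k, (0 < k)%N -> `|\sum_(1 <= a < (Y %/ k).+1) psi a| <= W) ->
  all prime s -> uniq s ->
  forall k, (0 < k)%N -> `|sifted_sum psi s (Y %/ k)| <= 2 ^+ size s * W.
Proof.
move=> psiM psi1 h; elim: s => [|p s IH] /=.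
  by move=> _ _ k k0; rewrite mul1r; apply: h.
case/andP => pp ps /andP[pns us] k k0.
rewrite sifted_sum_cons // exprS -mulrA mulr_natl mulr2n -divnMA.
apply: le_trans (ler_normB _ _) _; apply: lerD; first exact: IH.
rewrite normrM -[leRHS]mul1r ler_pM ?psi1 // IH // muln_gt0 k0 prime_gt0 //.
Qed.

Lemma coprime_all_primes (a n : nat) : (0 < a)%N -> (0 < n)%N ->
  coprime a n = all (fun p => ~~ (p %| a)%N) (primes n).
Proof.
move=> a0 n0; rewrite coprime_has_primes // -all_predC; apply: eq_in_all => p.
by rewrite mem_primes /= mem_primes a0 => /and3P[-> _ _].
Qed.

Lemma primes_all_prime n : all prime (primes n).
Proof. by apply/allP => p; rewrite mem_primes => /and3P[]. Qed.

(** The sum of [chi] is the sum of the primitive [psi] inducing it, sifted by the primes of [n];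
    each of the resulting 2^omega(n) sums is at most Y/E. *)
Lemma nonexceptional_sum_le (Y E n : nat) (chi : nat -> algC) b : (0 < n)%N ->
  (forall f, (f %| n)%N -> ~ exceptional Y E f) ->
  dchar n chi -> coprime b n -> chi b != 1 ->
  E%:R * `|\sum_(1 <= a < Y.+1) chi a| <= (2 ^ size (primes n) * Y)%:R.
Proof.
move=> n0 nex h cb nb.
have [f [psi [fn f1 hpsi prim psiE]]] := exists_primitive n0 h cb nb.
have [->|E0] := posnP E; first by rewrite mul0r ler0n.
have E0' : 0 < E%:R :> algC by rewrite ltr0n.
have small k : (0 < k)%N ->
    `|\sum_(1 <= a < (Y %/ k).+1) psi a| <= E%:R^-1 * Y%:R.
  move=> k0; rewrite -ler_pdivrMl ?invr_gt0 // invrK.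
  (* For k > E the sum has at most Y/k < Y/E terms; for k <= E smallness is the non-exceptionality
     of f. *)
  case: (leqP k E) => kE; last first.
    apply: (@le_trans _ _ (E%:R * (Y %/ k)%:R)).
      rewrite ler_wpM2l ?ler0n //.
      by apply: le_trans (norm_sum_dchar_le _ _ hpsi) _; rewrite ler_nat subSS subn0.
    rewrite -natrM ler_nat; apply: leq_trans (leq_trunc_div Y k).
    by rewrite mulnC leq_mul2l ltnW ?orbT.
  have [//|lt] := real_leP (ger0_real (mulr_ge0 (ler0n _ E) (normr_ge0 _))) (ger0_real (ler0n _ Y)).
  case: (nex f fn); split=> //; exists k; rewrite k0 kE; split => //.
  by exists psi; split => //; apply: ltW.
have -> : \sum_(1 <= a < Y.+1) chi a = sifted_sum psi (primes n) (Y %/ 1).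
  rewrite /sifted_sum divn1 big_mkcond [RHS]big_mkcond /=; apply: eq_big_nat.
  move=> a /andP[a0 _]; rewrite -coprime_all_primes //.
  by case: ifP => [/psiE //|/negbT]; exact: dchar0.
have := @sifted_sum_le _ psi Y _ (primes n) (dcharM hpsi) _ small (primes_all_prime n)
  (primes_uniq n) 1%N isT.
move=> /(_ (fun a => dchar_le1 a hpsi)) le.
rewrite -ler_pdivlMl //; apply: le_trans le _.
by rewrite natrM natrX mulrCA.
Qed.

Lemma coprime_count_le (R : realFieldType) (n t : nat) : (0 < n)%N ->
  `|(\sum_(1 <= a < t.+1 | coprime a n) 1) - t%:R * ((totient n)%:R / n%:R)|
    <= 2 ^+ size (primes n) :> R.
Proof.
move=> n0; pose dens s : R := \prod_(p <- s) (1 - p%:R^-1).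
have densE : (totient n)%:R / n%:R = dens (primes n).
  have en : n = (\prod_(p <- primes n) p ^ logn p n)%N.
    by rewrite [LHS]prod_prime_decomp // prime_decompE big_map.
  rewrite totientE // [X in _ / X%:R]en !natr_prod -prodf_div /dens.
  rewrite big_seq [RHS]big_seq; apply: eq_bigr => p; rewrite mem_primes => /and3P[pp _ pn].
  have p0 : p%:R != 0 :> R by rewrite pnatr_eq0 -lt0n prime_gt0.
  have l0 : (0 < logn p n)%N by rewrite logn_gt0 mem_primes pp n0.
  rewrite natrM !natrX -{2}(prednK l0) exprS -subn1 natrB ?prime_gt0 //.
  field; by rewrite expf_neq0 // p0.
have dens01 s : all prime s -> 0 <= dens s <= 1.
  elim: s => [|p s IH] /=; first by rewrite /dens big_nil ler01 lexx.
  case/andP => pp /IH; rewrite /dens big_cons => /andP[d0 d1].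
  have i0 : 0 <= p%:R^-1 :> R by rewrite invr_ge0.
  have i1 : p%:R^-1 <= 1 :> R by rewrite invf_le1 ?ler1n ?ltr0n prime_gt0.
  by apply/andP; split; nra.
(* The [- 1] makes room for the rounding of m/p, an error of at most 1 per step: 2 (2^s - 1) + 1 =
   2^(s+1) - 1. *)
have key s : all prime s -> uniq s -> forall m,
    `|sifted_sum (fun=> 1) s m - m%:R * dens s| <= 2 ^+ size s - 1.
  elim: s => [|p s IH] /=.
    move=> _ _ m; rewrite /sifted_sum /dens big_nil big_const_nat iter_addr subSS subn0.
    by rewrite addr0 mulr1 !subrr normr0.
  case/andP => pp ps /andP[pns us] m.
  rewrite sifted_sum_cons //; last by move=> *; rewrite mulr1.
  have := IH ps us m; have := IH ps us (m %/ p)%N; have /andP[] := dens01 s ps.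
  have -> : dens (p :: s) = (1 - p%:R^-1) * dens s by rewrite /dens big_cons.
  rewrite mul1r.
  set x := sifted_sum _ _ m; set y := sifted_sum _ _ _; set d := dens s.
  move=> d0 d1 hy hx; rewrite exprS.
  have p0 : 0 < p%:R :> R by rewrite ltr0n prime_gt0.
  have qle : (m %/ p)%:R <= m%:R / p%:R :> R.
    by rewrite ler_pdivlMr // -natrM ler_nat leq_trunc_div.
  have qge : m%:R / p%:R <= (m %/ p)%:R + 1 :> R.
    rewrite ler_pdivrMr // natr1 -natrM ler_nat ltnW // ltn_ceil ?prime_gt0 //.
  have -> : x - y - m%:R * ((1 - p%:R^-1) * d) =
     (x - m%:R * d) - (y - (m %/ p)%:R * d) + (m%:R / p%:R - (m %/ p)%:R) * d by ring.
  set e := m%:R / p%:R - (m %/ p)%:R.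
  have e0 : 0 <= e by rewrite subr_ge0.
  have e1 : e <= 1 by rewrite lerBlDl.
  have ed : 0 <= e * d <= 1.
    by rewrite mulr_ge0 //= -[leRHS]mulr1 ler_pM.
  move: hx hy; rewrite !ler_norml => /andP[? ?] /andP[? ?].
  by case/andP: ed => ? ?; apply/andP; split; lra.
rewrite densE.
have -> : \sum_(1 <= a < t.+1 | coprime a n) 1 = sifted_sum (fun=> 1) (primes n) t :> R.
  rewrite /sifted_sum big_mkcond [RHS]big_mkcond; apply: eq_big_nat => a /andP[a0 _].
  by rewrite coprime_all_primes.
apply: le_trans (key _ (primes_all_prime n) (primes_uniq n) t) _.
by rewrite gerBl.
Qed.

(** * Units modulo n and their characters *)

(** Off the units the value defaults to the identity, so every use is guarded by coprimality. *)
Definition unitmod (n a : nat) : {unit 'Z_n} := insubd (1%g : {unit 'Z_n}) (a%:R : 'Z_n).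

Section Units.
Variable n : nat.
Hypothesis n1 : (1 < n)%N.
Notation U := [set: {unit 'Z_n}]%G.

Lemma val_unitmod a : coprime a n -> val (unitmod n a) = a%:R.
Proof. by move=> c; rewrite val_insubd unitZpE // coprime_sym c. Qed.

Lemma unitmodM a b : coprime a n -> coprime b n ->
  unitmod n (a * b) = (unitmod n a * unitmod n b)%g.
Proof.
move=> ca cb; apply: val_inj; rewrite /= val_unitmod ?coprimeMl ?ca //.
by rewrite natrM !val_unitmod.
Qed.

Lemma unitmod1 : unitmod n 1 = 1%g.
Proof. by apply: val_inj; rewrite val_unitmod ?coprime1n. Qed.

Lemma natr_Zp_eq a b : ((a%:R : 'Z_n) == b%:R) = (a == b %[mod n]).
Proof. by rewrite -val_eqE /= !val_Zp_nat. Qed.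

Lemma unitmod_mod a : unitmod n (a %% n) = unitmod n a.
Proof. by rewrite /unitmod Zp_nat_mod. Qed.

Lemma unitmodX a k : coprime a n -> (unitmod n a ^+ k)%g = unitmod n (a ^ k).
Proof.
move=> ca; elim: k => [|k IH]; first by rewrite expg0 unitmod1.
by rewrite expgS IH expnS unitmodM // coprimeXl.
Qed.

Lemma unitmodX_eq1 a k : coprime a n ->
  (unitmod n a ^+ k == 1)%g = (a ^ k == 1 %[mod n]).
Proof.
move=> ca; rewrite unitmodX // -val_eqE /= val_unitmod ?coprimeXl //.
by rewrite -natr_Zp_eq.
Qed.

Lemma unitmod_surj (x : {unit 'Z_n}) :
  exists b, [/\ (b < n)%N, coprime b n & unitmod n b = x].
Proof.
have lt : (val x < n)%N by have := ltn_ord (val x); rewrite [X in (_ < X)%N](Zp_cast n1).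
have e : (val x : nat)%:R = val x by rewrite natr_Zp.
exists (val x : nat); have c : coprime (val x) n.
  by rewrite coprime_sym -unitZpE // e; exact: (valP x).
by split => //; apply: val_inj; rewrite val_unitmod.
Qed.

Lemma card_units_le : (#|U| <= n)%N.
Proof.
rewrite cardsT; apply: leq_trans (leq_card _ val_inj) _.
by rewrite card_ord Zp_cast.
Qed.

Lemma order_unitmod_le a : (#[unitmod n a]%g <= n)%N.
Proof.
by apply: leq_trans card_units_le; rewrite dvdn_leq // order_dvdG ?inE.
Qed.

Lemma ordmodE a : coprime a n -> ordmod n a = #[unitmod n a]%g.
Proof.
move=> ca; rewrite /ordmod; set p := (fun k => _).
have pE k : p k = (#[unitmod n a]%g %| k.+1)%N by rewrite order_dvdn unitmodX_eq1.
set o := #[unitmod n a]%g in pE *.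
have o0 : (0 < o)%N by exact: order_gt0.
have on : (o <= n)%N by exact: order_unitmod_le.
have hp : has p (iota 0 n).
  apply/hasP; exists o.-1; first by rewrite mem_iota; lia.
  by rewrite pE prednK.
have fn : (find p (iota 0 n) < n)%N by move: hp; rewrite has_find size_iota.
have := nth_find 0 hp; rewrite nth_iota // add0n pE => /dvdn_leq -/(_ isT) le.
apply/eqP; rewrite eqn_leq le andbT leqNgt; apply/negP => lt.
have lt' : (o.-1 < find p (iota 0 n))%N by lia.
have := before_find 0 lt'; rewrite nth_iota; last lia.
by rewrite add0n pE prednK // dvdnn.
Qed.

Lemma order_dvd_carmichael (x : {unit 'Z_n}) : (#[x]%g %| carmichael n)%N.
Proof.
have [b [bn cb <-]] := unitmod_surj x.
by rewrite -ordmodE // /carmichael (biglcmn_sup (Ordinal bn)).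
Qed.

Lemma carmichael_dvd m : (forall x : {unit 'Z_n}, x ^+ m = 1)%g -> (carmichael n %| m)%N.
Proof.
move=> h; apply/dvdn_biglcmP => b cb; by rewrite ordmodE // order_dvdn h.
Qed.

Lemma carmichael_dvd_card : (carmichael n %| #|U|)%N.
Proof. by apply: carmichael_dvd => x; apply: expg_cardG; rewrite inE. Qed.

Lemma carmichael_gt0 : (0 < carmichael n)%N.
Proof. exact: dvdn_gt0 (cardG_gt0 U) carmichael_dvd_card. Qed.

Lemma units_abelian : abelian U.
Proof. by apply/centsP => x _ y _; apply: val_inj; exact: mulrC. Qed.

(** * Subgroups detected by the characters of the quotient *)

Section Subgroup.
Variable H : {group {unit 'Z_n}}.
Let Q := (U / H)%G.
Let norm_H (x : {unit 'Z_n}) : x \in 'N(H)%g.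
Proof.
have := fintype.subsetP (sub_abelian_norm units_abelian (finset.subsetT H)) x.
by apply; rewrite inE.
Qed.
Let coset_Q (x : {unit 'Z_n}) : coset H x \in Q.
Proof. by rewrite mem_quotient // inE. Qed.
Let abQ : abelian Q. Proof. exact: quotient_abelian units_abelian. Qed.
Let linQ (i : Iirr Q) : 'chi_i \is a linear_char. Proof. exact/char_abelianP. Qed.
Let cardQ : #|Q| = #|U : H|%g.
Proof.
rewrite card_quotient //; apply/fintype.subsetP => x _; exact: norm_H.
Qed.

Definition subgroup_char (i : Iirr Q) (a : nat) : algC :=
  if coprime a n then 'chi_i (coset H (unitmod n a)) else 0.

Lemma subgroup_charP i : dchar n (subgroup_char i).
Proof.
split; rewrite /subgroup_char.
- by rewrite coprime1n unitmod1 coset_id ?group1 // lin_char1.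
- move=> a b; rewrite coprimeMl.
  case: (boolP (coprime a n)) => ca /=; last by rewrite mul0r.
  case: (boolP (coprime b n)) => cb /=; last by rewrite mulr0.
  by rewrite unitmodM // (morphM (coset_morphism H)) ?norm_H // lin_charM ?coset_Q.
- by move=> a; rewrite coprime_modl unitmod_mod.
- by move=> a ca; rewrite ca normC_lin_char ?coset_Q.
- by move=> a /negbTE ->.
Qed.

Lemma subgroup_char_nonprincipal i : i != 0 ->
  exists2 b, coprime b n & subgroup_char i b != 1.
Proof.
move=> i0; apply: contrapT => nb; case/eqP: i0; apply: irr_inj; rewrite irr0.
apply/cfunP => y; rewrite cfun1E; case: (boolP (y \in Q)) => [|yQ]; last first.
  by rewrite cfun0.
case/morphimP => x _ _ ->; have [b [_ cb <-]] := unitmod_surj x.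
apply: contrapT => ne; apply: nb; exists b => //.
by rewrite /subgroup_char cb; apply/eqP.
Qed.

Lemma subgroup_char0 a : subgroup_char 0 a = (coprime a n)%:R.
Proof. by rewrite /subgroup_char irr0 cfun1E coset_Q; case: ifP. Qed.

(** The irreducible characters of the abelian quotient are linear, so their sum is its regular
    character: the index at the identity coset and 0 elsewhere. *)
Lemma sum_subgroup_char a :
  \sum_i subgroup_char i a = (#|U : H|%g * (coprime a n && (unitmod n a \in H)))%:R.
Proof.
rewrite /subgroup_char; case: (boolP (coprime a n)) => ca; last by rewrite big1 ?muln0.
have := cfRegE Q (coset H (unitmod n a)).
rewrite cfReg_sum sum_cfunE cardQ -mulr_natr -natrM /=.
move=> e; rewrite (eq_bigr (fun i => ('chi_i 1%g *: 'chi_i) (coset H (unitmod n a)))).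
  rewrite e; congr (_ * _)%:R; congr nat_of_bool.
  by apply/eqP/idP => [|h]; [move/coset_idr; apply|rewrite coset_id].
by move=> i _; rewrite cfunE lin_char1 // mul1r.
Qed.

Lemma card_Iirr_index : #|Iirr Q| = #|U : H|%g.
Proof. by rewrite card_Iirr_abelian // cardQ. Qed.

Lemma sum_subgroup_mem (r : seq nat) :
  (#|U : H|%g * (\sum_(a <- r | coprime a n && (unitmod n a \in H)) 1))%:R =
  (\sum_(a <- r | coprime a n) 1)%:R +
     \sum_(i : Iirr Q | i != 0) \sum_(a <- r) subgroup_char i a.
Proof.
have -> : (\sum_(a <- r | coprime a n) 1)%:R = \sum_(a <- r) subgroup_char 0 a :> algC.
  rewrite big_mkcond natr_sum; apply: eq_bigr => a _; rewrite subgroup_char0.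
  by case: ifP.
rewrite -(bigD1 (0 : Iirr Q) (P := predT) (F := fun i => \sum_(a <- r) subgroup_char i a)) //.
rewrite exchange_big big_mkcond big_distrr natr_sum; apply: eq_bigr => a _.
by rewrite sum_subgroup_char; case: (_ && _).
Qed.

(** The identity of [sum_subgroup_mem] over a full period, where every nonprincipal sum vanishes. *)
Lemma index_mul_residues :
  (#|U : H|%g * (\sum_(0 <= b < n | coprime b n && (unitmod n b \in H)) 1))%N = totient n.
Proof.
apply/eqP; rewrite -(eqr_nat algC); rewrite sum_subgroup_mem [X in _ + X]big1 ?addr0.
  rewrite eqr_nat totient_count_coprime big_mkcond; apply/eqP; apply: eq_bigr => b _.
  by rewrite coprime_sym; case: (coprime n b).
move=> i /subgroup_char_nonprincipal[b cb nb].
exact: dchar_sum0 (ltnW n1) (subgroup_charP i) cb nb.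
Qed.

(** Stated with cleared denominators in [nat], so that an estimate proved in [algC] can be
    transported to any real field. *)
Lemma subgroup_count_le (Y E : nat) :
  (forall f, (f %| n)%N -> ~ exceptional Y E f) ->
  let A := (\sum_(1 <= a < Y.+1 | coprime a n && (unitmod n a \in H)) 1)%N in
  let B := (\sum_(1 <= a < Y.+1 | coprime a n) 1)%N in
  let e := (#|U : H|%g * (2 ^ size (primes n) * Y))%N in
  (E * (#|U : H|%g * A) <= E * B + e)%N /\ (E * B <= E * (#|U : H|%g * A) + e)%N.
Proof.
move=> nex A B e.
have := sum_subgroup_mem (index_iota 1 Y.+1); rewrite -/A -/B.
set S := \sum_(i | _) _ => eS.
have SE : E%:R * `|S| <= e%:R.
  apply: (@le_trans _ _ (\sum_(i : Iirr Q | i != 0) (2 ^ size (primes n) * Y)%:R)).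
    apply: le_trans (ler_wpM2l (ler0n _ _) (ler_norm_sum _ _ _)) _.
    rewrite mulr_sumr; apply: ler_sum => i /subgroup_char_nonprincipal[b cb nb].
    exact: nonexceptional_sum_le (ltnW n1) nex (subgroup_charP i) cb nb.
  rewrite sumr_const -[leLHS]mulr_natr -natrM ler_nat /e mulnC leq_mul2r.
  by rewrite -card_Iirr_index max_card orbT.
(* As a difference of two integers [S] is real, so the bound on its norm gives both inequalities. *)
have SR : S \is Num.real.
  have -> : S = (#|U : H|%g * A)%:R - B%:R by rewrite eS addrC addKr.
  by rewrite rpredB ?realn.
have : `|E%:R * S| <= e%:R by rewrite normrM normr_nat.
rewrite real_ler_norml ?rpredM ?realn // => /andP[lo hi].
split; rewrite -(ler_nat algC) natrD [(E * (_ * A))%:R]natrM [(E * B)%:R]natrM eS mulrDr.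
  by rewrite lerD2l.
by rewrite -addrA lerDl -lerBlDr sub0r.
Qed.

End Subgroup.

(* The index is divisible by every prime q | d, because some unit x has
   x ^ (carmichael n / q) <> 1, and then q divides the order of x modulo the kernel. *)
Lemma prime_dvd_index_Ldiv d q : prime q -> (q %| d)%N -> (d %| carmichael n)%N ->
  forall K : {group {unit 'Z_n}}, K = 'Ldiv_(carmichael n %/ d)(U)%g :> {set _} ->
  (q %| #|U : K|%g)%N.
Proof.
set c := carmichael n => pq qd dc K KE.
have c0 : (0 < c)%N := carmichael_gt0.
have d0 : (0 < d)%N := dvdn_gt0 c0 dc.
have [x nx] : exists x : {unit 'Z_n}, (x ^+ (c %/ q) != 1)%g.
  apply: contrapT => h; have : (c %| c %/ q)%N.
    apply: carmichael_dvd => x; apply/eqP; apply: contrapT => /negP nx.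
    by apply: h; exists x.
  move/dvdn_leq; rewrite divn_gt0 ?prime_gt0 // (dvdn_leq c0 (dvdn_trans qd dc)).
  by move/(_ isT); rewrite leqNgt ltn_Pdiv // prime_gt1.
have nK (y : {unit 'Z_n}) : y \in 'N(K)%g.
  have := fintype.subsetP (sub_abelian_norm units_abelian (finset.subsetT K)) y.
  by apply; rewrite inE.
have memK y : (y \in K) = (y ^+ (c %/ d) == 1)%g.
  by rewrite -[_ \in K]/(y \in (K : {set _})) KE !inE.
have oX j : (coset K x ^+ j == 1)%g = (x ^+ (j * (c %/ d)) == 1)%g.
  rewrite -morphX //; apply/eqP/idP => [/coset_idr|] h.
    by rewrite expgM -memK h.
  by rewrite /= coset_id // memK -expgM.
have od : (#[coset K x]%g %| d)%N.
  rewrite order_dvdn oX mulnC divnK //; rewrite -order_dvdn.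
  exact: order_dvd_carmichael.
have : (#[coset K x]%g %| #|U : K|%g)%N.
  rewrite -card_quotient; last by apply/fintype.subsetP => y _; exact: nK.
  by rewrite order_dvdG // mem_quotient // inE.
apply: dvdn_trans; apply: contraR nx => nq.
have : (#[coset K x]%g %| d %/ q)%N.
  have := od; rewrite -{1}(divnK qd) Gauss_dvdl //.
  by rewrite coprime_sym prime_coprime.
rewrite order_dvdn oX; congr (x ^+ _ == 1)%g.
have e : c = (d %/ q * (c %/ d) * q)%N by rewrite mulnAC divnK // mulnC divnK.
by rewrite [X in (_ = X %/ q)%N]e mulnK ?prime_gt0.
Qed.

End Units.

(** * Truncated inclusion-exclusion *)

(** Level [k] of the inclusion-exclusion: for distinct primes, the squarefree products of exactly
    [k] of them. *)
Fixpoint subprods (Q : seq nat) (k : nat) : seq nat :=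
  match Q, k with
  | _, 0 => [:: 1]%N
  | [::], _.+1 => [::]
  | q :: Q', k'.+1 => subprods Q' k ++ [seq (q * d)%N | d <- subprods Q' k']
  end.

Lemma subprods0 Q : subprods Q 0 = [:: 1]%N. Proof. by case: Q. Qed.

Lemma size_subprods Q k : size (subprods Q k) = 'C(size Q, k).
Proof.
elim: Q k => [|q Q IH] [|k] //=.
by rewrite size_cat size_map !IH binS.
Qed.

Lemma coprime_subprods q Q k d : prime q -> all prime Q -> q \notin Q ->
  d \in subprods Q k -> coprime q d.
Proof.
move=> pq; elim: Q k d => [|p Q IH] [|k] d //=.
- by move=> _ _; rewrite inE => /eqP ->; rewrite coprimen1.
- by move=> _ _; rewrite inE => /eqP ->; rewrite coprimen1.
case/andP => pp aQ; rewrite inE negb_or => /andP[qp qQ].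
rewrite mem_cat => /orP[|/mapP[d' hd' ->]]; first exact: IH.
rewrite coprimeMr (IH _ _ aQ qQ hd') andbT prime_coprime // dvdn_prime2 //.
Qed.

(** These products are squarefree, so divisibility may be tested prime by prime; it is applied with
    [N] the Carmichael value and with [N] a subgroup index. *)
Lemma subprods_dvd Q k d N : all prime Q -> uniq Q -> d \in subprods Q k ->
  (forall q, q \in Q -> (q %| d)%N -> (q %| N)%N) -> (d %| N)%N.
Proof.
elim: Q k d => [|p Q IH] [|k] d //=.
- by move=> _ _; rewrite inE => /eqP ->.
- by move=> _ _; rewrite inE => /eqP ->.
case/andP => pp aQ /andP[pQ uQ]; rewrite mem_cat => /orP[h H|/mapP[d' hd' ->] H].
  by apply: IH aQ uQ h _ => q qQ; apply: H; rewrite inE qQ orbT.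
rewrite Gauss_dvd ?(coprime_subprods pp aQ pQ hd') //; apply/andP; split.
  by apply: H; rewrite ?inE ?eqxx ?dvdn_mulr.
apply: IH aQ uQ hd' _ => q qQ qd; apply: H; first by rewrite inE qQ orbT.
by rewrite dvdn_mull.
Qed.

Lemma subprods_gt0 Q k d : all prime Q -> d \in subprods Q k -> (0 < d)%N.
Proof.
elim: Q k d => [|p Q IH] [|k] d //=; try by move=> _; rewrite inE => /eqP ->.
case/andP => pp aQ; rewrite mem_cat => /orP[|/mapP[d' hd' ->]]; first exact: IH.
by rewrite muln_gt0 prime_gt0 // (IH _ _ aQ hd').
Qed.

Lemma count_subprods_dvd Q k t : all prime Q -> uniq Q ->
  count (fun d => d %| t)%N (subprods Q k) = 'C(count (fun q => q %| t)%N Q, k).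
Proof.
elim: Q k => [|q Q IH] [|k] //=; try by move=> _ _; rewrite dvd1n bin0.
case/andP => pq aQ /andP[qQ uQ]; rewrite count_cat IH // count_map.
have -> : count (preim (muln q) (fun d => d %| t)%N) (subprods Q k) =
    ((q %| t) * 'C(count (fun q => q %| t)%N Q, k))%N.
  rewrite -IH //; case: (boolP (q %| t)%N) => qt.
    rewrite mul1n; apply: eq_in_count => d hd /=.
    by rewrite Gauss_dvd ?(coprime_subprods pq aQ qQ hd) // qt.
  rewrite mul0n; apply/eqP; rewrite -leqn0 leqNgt -has_count; apply/hasPn => d _ /=.
  by apply: contra qt; apply: dvdn_trans; rewrite dvdn_mulr.
by case: (q %| t)%N; rewrite /= ?add1n ?binS ?mul1n ?add0n ?mul0n ?addn0.
Qed.

Lemma sum_inv_subprods (R : realFieldType) Q k :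
  \sum_(d <- subprods Q k) d%:R^-1 <= (\sum_(q <- Q) q%:R^-1) ^+ k / k`!%:R :> R.
Proof.
elim: Q k => [|q Q IH] [|k].
- by rewrite /= big_seq1 fact0 expr0 div1r.
- by rewrite /= !big_nil expr0n mul0r.
- by rewrite subprods0 big_seq1 fact0 expr0 div1r.
rewrite /= big_cat big_map /= big_cons.
under [X in _ + X <= _]eq_bigr do rewrite natrM invfM.
rewrite -mulr_sumr.
set s := \sum_(q <- Q) _; set x := q%:R^-1.
have x0 : 0 <= x by rewrite invr_ge0.
have s0 : 0 <= s by apply: sumr_ge0 => p _; rewrite invr_ge0.
apply: le_trans (lerD (IH _) (ler_wpM2l x0 (IH k))) _; rewrite -/s.
have f0 : 0 < k`!%:R :> R by rewrite ltr0n fact_gt0.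
have k0 : 0 < k.+1%:R :> R by rewrite ltr0n.
rewrite factS natrM ler_pdivlMr ?mulr_gt0 // mulrDl.
have -> : s ^+ k.+1 / (k.+1%:R * k`!%:R) * (k.+1%:R * k`!%:R) = s ^+ k.+1.
  by rewrite divfK // mulf_neq0 ?gt_eqF.
have -> : x * (s ^+ k / k`!%:R) * (k.+1%:R * k`!%:R) = k.+1%:R * x * s ^+ k.
  by field; rewrite gt_eqF.
(* Bernoulli: the first two terms of the binomial expansion *)
elim: k {IH f0 k0} => [|k IH]; first by rewrite expr1 expr0; nra.
rewrite [leRHS]exprS; apply: le_trans (ler_wpM2l (addr_ge0 x0 s0) IH).
have : 0 <= s ^+ k by rewrite exprn_ge0.
rewrite -[k.+2%:R]natr1 !exprS; set z := s ^+ k => z0.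
have : 0 <= k.+1%:R :> R by []; set m := k.+1%:R => m0.
have -> : (x + s) * (s * z + m * x * z) = s * (s * z) + (m + 1) * x * (s * z) + m * x * x * z by ring.
by rewrite lerDl !mulr_ge0.
Qed.

Lemma leq_bin_mul n k : ('C(n, k.+1) <= n * 'C(n, k))%N.
Proof.
apply: (@leq_trans (k.+1 * 'C(n, k.+1))); first by rewrite leq_pmull.
by rewrite mul_bin_left leq_mul // leq_subr.
Qed.

Lemma sum_bin_le n k : (\sum_(0 <= j < k.+1) 'C(n, j) <= n.+1 ^ k)%N.
Proof.
have b j : ('C(n, j) <= n ^ j)%N.
  elim: j => [|j IH]; first by rewrite bin0.
  by rewrite expnS (leq_trans (leq_bin_mul _ _)) // leq_mul.
elim: k => [|k IH]; first by rewrite big_nat1 bin0.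
rewrite big_nat_recr //= expnS mulSn leq_add //.
rewrite (leq_trans (b _)) // expnS leq_mul //.
by case: k {IH} => // k; rewrite leq_exp2r.
Qed.

(** For b > 0 the first k > 0 terms collapse to (-1)^(k-1) C(b-1, k-1), and C(b-1, k-1) <= C(b,
    k-1+1) by Pascal's rule. *)
Lemma bonferroni (R : realDomainType) (b k : nat) :
  `|(b == 0)%:R - \sum_(0 <= j < k) (-1) ^+ j * 'C(b, j)%:R| <= 'C(b, k)%:R :> R.
Proof.
case: k => [|k].
  by rewrite big_geq // subr0 normr_nat bin0 lern1 leq_b1.
case: b => [|b].
  rewrite big_ltn // expr0 bin0 mulr1 big_nat_cond big1 ?addr0 ?subrr ?normr0 //.
  by move=> [|j] //= _; rewrite mulr0.
rewrite sub0r normrN.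
have -> : \sum_(0 <= j < k.+1) (-1) ^+ j * 'C(b.+1, j)%:R = (-1) ^+ k * 'C(b, k)%:R :> R.
  elim: k => [|k IH]; first by rewrite big_nat1 !bin0.
  by rewrite big_nat_recr //= IH binS natrD exprS; ring.
rewrite normrM normrX normrN1 expr1n mul1r normr_nat ler_nat binS.
exact: leq_addl.
Qed.

Section CountLprim.
Variables (R : realFieldType) (n : nat).
Hypothesis n1 : (1 < n)%N.
Let c := carmichael n.
Let Q := primes c.
(** For a unit a and a prime q of c, q divides [t a] exactly when a^(c/q) = 1; a lambda-primitive
    root is a unit with no such q. *)
Let t a := (c %/ ordmod n a)%N.
Let N d (r : seq nat) : R := \sum_(a <- r | coprime a n && (d %| t a)%N) 1.
Let X (r : seq nat) : R := \sum_(a <- r | lprim n a) 1.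

Let c0 : (0 < c)%N. Proof. exact: carmichael_gt0. Qed.
Let ord_dvd a : coprime a n -> (ordmod n a %| c)%N.
Proof. by move=> ca; rewrite ordmodE // order_dvd_carmichael. Qed.

Let t0 a : coprime a n -> (0 < t a)%N.
Proof.
by move=> ca; rewrite divn_gt0 ?(dvdn_leq c0 (ord_dvd ca)).
Qed.

Let count0 a : coprime a n ->
  (ordmod n a == c) = (count (fun q => q %| t a)%N Q == 0)%N.
Proof.
move=> ca; have o := ord_dvd ca; have o0 := dvdn_gt0 c0 o.
have -> : (ordmod n a == c) = (t a == 1)%N.
  by rewrite /t [RHS]eq_sym eqn_div // mul1n.
rewrite -leqn0 leqNgt -has_count; apply/eqP/hasPn => [-> q|h].
  rewrite mem_primes dvdn1 => /and3P[pq _ _]; apply/eqP => q1; by rewrite q1 in pq.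
apply/eqP; rewrite eqn_leq t0 // andbT leqNgt; apply/negP => t1.
have := h (pdiv (t a)); rewrite pdiv_dvd mem_primes pdiv_prime // c0 /=.
have -> : (pdiv (t a) %| c)%N.
  by apply: dvdn_trans (pdiv_dvd _) _; rewrite -(divnK o) dvdn_mulr.
by move/(_ isT).
Qed.

Let Qp : all prime Q. Proof. exact: primes_all_prime. Qed.
Let Qu : uniq Q. Proof. exact: primes_uniq. Qed.

Let X_truncated k r :
  `|X r - \sum_(0 <= j < k) (-1) ^+ j * \sum_(d <- subprods Q j) N d r|
    <= \sum_(d <- subprods Q k) N d r.
Proof.
have NE j : \sum_(d <- subprods Q j) N d r =
    \sum_(a <- r | coprime a n) ('C(count (fun q => q %| t a)%N Q, j))%:R.
  under eq_bigr do rewrite /N big_mkcondr.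
  rewrite exchange_big; apply: eq_bigr => a ca.
  by rewrite -count_subprods_dvd // -big_mkcond /= -sum1_count natr_sum.
have XE : X r = \sum_(a <- r | coprime a n) (count (fun q => q %| t a)%N Q == 0)%:R.
  rewrite /X big_mkcondr /=; apply: eq_bigr => a ca.
  by rewrite -count0 //; case: ifP.
have -> : \sum_(0 <= j < k) (-1) ^+ j * \sum_(d <- subprods Q j) N d r =
    \sum_(a <- r | coprime a n) \sum_(0 <= j < k)
      (-1) ^+ j * ('C(count (fun q => q %| t a)%N Q, j))%:R.
  by under eq_bigr do rewrite NE mulr_sumr; exact: exchange_big.
rewrite XE NE -sumrB.
apply: le_trans (ler_norm_sum _ _ _) _; apply: ler_sum => a _.
exact: bonferroni.
Qed.

(** K is the kernel of x -> x^(c/d). Each prime of the squarefree d divides its index, hence so does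
    d. *)
Let N_index d j : d \in subprods Q j -> exists K : {group {unit 'Z_n}},
  (d <= #|[set: {unit 'Z_n}]%G : K|%g)%N /\
  forall a, coprime a n -> (d %| t a)%N = (unitmod n a \in K).
Proof.
move=> hd; have dc : (d %| c)%N.
  apply: (subprods_dvd Qp Qu hd) => q; by rewrite mem_primes => /and3P[].
have d0 : (0 < d)%N := dvdn_gt0 c0 dc.
pose K := group (group_Ldiv (c %/ d) (units_abelian n)).
exists K; split.
  apply: dvdn_leq; first exact: indexg_gt0.
  apply: (subprods_dvd Qp Qu hd) => q qQ qd.
  apply: (prime_dvd_index_Ldiv n1 _ qd dc); last by [].
  by move: qQ; rewrite mem_primes => /and3P[].
move=> a ca; have o := ord_dvd ca; have o0 := dvdn_gt0 c0 o.
rewrite /t dvdn_divRL // mulnC -dvdn_divRL // ordmodE // order_dvdn.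
by rewrite !inE.
Qed.

Let Y_count Y : R := \sum_(1 <= a < Y.+1 | coprime a n) 1.

Let N_approx Y E d j : (0 < E)%N ->
  (forall f, (f %| n)%N -> ~ exceptional Y E f) -> d \in subprods Q j ->
  `|N d (index_iota 1 Y.+1) - Y_count Y * (N d (index_iota 0 n) / (totient n)%:R)|
     <= 2 ^+ size (primes n) * Y%:R / E%:R /\
  N d (index_iota 0 n) / (totient n)%:R <= d%:R^-1.
Proof.
move=> E0 nex hd; have [K [dK KE]] := N_index hd.
have d0 := subprods_gt0 Qp hd.
have NE r : N d r = (\sum_(a <- r | coprime a n && (unitmod n a \in K)) 1)%:R.
  rewrite natr_sum; apply: eq_bigl => a.
  by case: (boolP (coprime a n)) => //= ca; rewrite KE.
have [h1 h2] := subgroup_count_le n1 K nex.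
have h3 := index_mul_residues n1 K.
rewrite !NE /Y_count.
have -> : \sum_(1 <= a < Y.+1 | coprime a n) 1 = (\sum_(1 <= a < Y.+1 | coprime a n) 1)%:R :> R.
  by rewrite natr_sum.
move: h1 h2 h3; set m := #|_ : K|%g in dK *.
set A := (\sum_(1 <= a < Y.+1 | coprime a n && _) 1)%N.
set B := (\sum_(1 <= a < Y.+1 | coprime a n) 1)%N.
set M := (\sum_(0 <= a < n | coprime a n && _) 1)%N.
rewrite -!(ler_nat R) => h1 h2 /(congr1 (fun x => x%:R : R)); rewrite natrM => h3.
have m0n : (0 < m)%N by apply: leq_trans d0 dK.
have m0 : 0 < m%:R :> R by rewrite ltr0n.
have E0' : 0 < E%:R :> R by rewrite ltr0n.
have p0 : 0 < (totient n)%:R :> R by rewrite ltr0n totient_gt0 ltnW.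
have -> : M%:R / (totient n)%:R = m%:R^-1 :> R.
  rewrite -h3 invfM mulrCA divff ?mulr1 //.
  apply/eqP => M0; by move: p0; rewrite -h3 M0 mulr0 ltxx.
split; last by rewrite lef_pV2 ?posrE ?ltr0n // ler_nat.
move: h1 h2; rewrite !natrD !natrM natrX.
set w := 2 ^+ _ * Y%:R => h1 h2.
have -> : A%:R - B%:R / m%:R = (E%:R * (m%:R * A%:R) - E%:R * B%:R) / (E%:R * m%:R) :> R.
  by field; rewrite !gt_eqF.
have -> : w / E%:R = (m%:R * w) / (E%:R * m%:R) by field; rewrite !gt_eqF.
rewrite normrM (ger0_norm (x := (E%:R * m%:R)^-1)) ?invr_ge0 ?mulr_ge0 //.
rewrite ler_pM2r ?invr_gt0 ?mulr_gt0 // ler_norml.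
by apply/andP; split; lra.
Qed.

(** The count up to Y and the count R(n) over a period are truncated at the same level and compared
    term by term after scaling by the number of units up to Y over phi(n). The three errors come
    from the character sums, from the two truncation tails, and from replacing that scale by Y/n. *)
Lemma count_lprim_le Y E k : (0 < E)%N ->
  (forall f, (f %| n)%N -> ~ exceptional Y E f) ->
  `|(\sum_(1 <= a < Y.+1 | lprim n a) 1) - Y%:R * ((Rcount n)%:R / n%:R)|
  <= (size Q).+1%:R ^+ k * (2 ^+ size (primes n) * Y%:R / E%:R) +
     2 * Y%:R * (\sum_(d <- subprods Q k) d%:R^-1) + 2 ^+ size (primes n) :> R.
Proof.
move=> E0 nex; rewrite -/(X (index_iota 1 Y.+1)).
have -> : (Rcount n)%:R = X (index_iota 0 n).
  by rewrite /Rcount natr_sum /X big_mkord.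
set rY := index_iota 1 Y.+1; set rn := index_iota 0 n.
set w := 2 ^+ _ * _ / _; set W := 2 ^+ size (primes n).
pose ph : R := (totient n)%:R; pose C := Y_count Y.
have p0 : 0 < ph by rewrite ltr0n totient_gt0 ltnW.
have n0 : 0 < n%:R :> R by rewrite ltr0n ltnW.
have C0 : 0 <= C by apply: sumr_ge0.
have CY : C <= Y%:R.
  rewrite /C /Y_count big_mkcond /=.
  apply: (@le_trans _ _ (\sum_(1 <= a < Y.+1) 1)); first by apply: ler_sum => a _; case: ifP.
  by rewrite big_const_nat iter_addr addr0 subSS subn0.
pose An j := \sum_(d <- subprods Q j) N d rY.
pose Bn j := \sum_(d <- subprods Q j) N d rn.
have AB j : `|An j - C * (Bn j / ph)| <= 'C(size Q, j)%:R * w.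
  have -> : An j - C * (Bn j / ph) =
      \sum_(d <- subprods Q j) (N d rY - C * (N d rn / ph)).
    by rewrite sumrB -mulr_sumr -mulr_suml.
  rewrite -size_subprods.
  apply: le_trans (ler_norm_sum _ _ _) _.
  rewrite big_seq; apply: (@le_trans _ _ (\sum_(d <- subprods Q j | d \in subprods Q j) w)).
    by apply: ler_sum => d /(N_approx E0 nex)[].
  by rewrite -big_seq big_const_seq count_predT iter_addr addr0 mulr_natl.
have Bk : Bn k / ph <= \sum_(d <- subprods Q k) d%:R^-1.
  rewrite mulr_suml big_seq [leRHS]big_seq; apply: ler_sum => d.
  by case/(N_approx E0 nex).
have TA := X_truncated k rY; have TB := X_truncated k rn.
rewrite -/(An k) -/(Bn k) in TA TB.
set SA := \sum_(0 <= j < k) _ in TA; set SB := \sum_(0 <= j < k) _ in TB.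
have w0 : 0 <= w by rewrite divr_ge0 ?mulr_ge0 ?exprn_ge0.
have SAB : `|SA - C * (SB / ph)| <= (\sum_(0 <= j < k) 'C(size Q, j))%:R * w.
  have -> : SA - C * (SB / ph) = \sum_(0 <= j < k) (-1) ^+ j * (An j - C * (Bn j / ph)).
    rewrite [X in _ - C * X]mulr_suml [X in _ - X]mulr_sumr -sumrB.
    by apply: eq_bigr => j _; rewrite -/(An j) -/(Bn j); ring.
  apply: le_trans (ler_norm_sum _ _ _) _; rewrite natr_sum mulr_suml.
  by apply: ler_sum => j _; rewrite normrM normrX normrN1 expr1n mul1r AB.
have TB' : `|C * (X rn / ph) - C * (SB / ph)| <= C * (Bn k / ph).
  rewrite -mulrBr -mulrBl normrM (ger0_norm C0) normrM (ger0_norm (x := ph^-1)) ?invr_ge0 ?(ltW p0) //.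
  by rewrite ler_wpM2l // ler_pM2r ?invr_gt0.
have XC : `|C * (X rn / ph) - Y%:R * (X rn / n%:R)| <= W.
  have cc := coprime_count_le R Y (ltnW n1); rewrite -/(Y_count Y) -/C -/ph -/W in cc.
  have -> : C * (X rn / ph) - Y%:R * (X rn / n%:R) = (C - Y%:R * (ph / n%:R)) * (X rn / ph).
    by field; rewrite !gt_eqF.
  rewrite normrM -[leRHS]mulr1 ler_pM //.
  have X0 : 0 <= X rn by apply: sumr_ge0.
  rewrite ger0_norm ?divr_ge0 ?(ltW p0) // ler_pdivrMr // mul1r.
  rewrite /ph totient_count_coprime natr_sum /X big_mkcond; apply: ler_sum => b _.
  rewrite /lprim coprime_sym; by case: (coprime n b) => //=; case: ifP.
(* The additional level k comes from the truncation tail of the count up to Y, itself compared with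
   its counterpart over a period. *)
have SS : (\sum_(0 <= j < k) 'C(size Q, j))%:R * w + 'C(size Q, k)%:R * w
    <= (size Q).+1%:R ^+ k * w.
  rewrite -mulrDl ler_wpM2r // -natrD -natrX ler_nat.
  by apply: leq_trans (sum_bin_le _ _); rewrite big_nat_recr.
have CB : C * (Bn k / ph) <= Y%:R * \sum_(d <- subprods Q k) d%:R^-1.
  rewrite ler_pM // divr_ge0 ?(ltW p0) // sumr_ge0 // => d _; exact: sumr_ge0.
have ABk := AB k.
move: TA SAB TB' XC ABk SS CB; rewrite -(mulrA 2).
move: (C * (SB / ph)) (C * (X rn / ph)) (Y%:R * (X rn / n%:R)) (C * (Bn k / ph)).
move: (_ * w) ('C(size Q, k)%:R * w) ((size Q).+1%:R ^+ k * w).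
move: (Y%:R * _) (An k) (X rY) SA W => x1 x2 x3 x4 x5 x6 x7 x8 x9 x10 x11 x12.
rewrite !ler_norml.
move=> /andP[? ?] /andP[? ?] /andP[? ?] /andP[? ?] /andP[? ?] ? ?.
by apply/andP; split; lra.
Qed.

End CountLprim.

(** * Sparsity of the exceptional conductors *)

Section Sparsity.
Variable R : realType.
Implicit Types (u w : R).

Lemma ln_le_sub1 (x : R) : 0 < x -> ln x <= x - 1.
Proof.
move=> x0; have e : 1 + (x - 1) = x by ring.
by rewrite -{1}e le_ln1Dx //; lra.
Qed.

Lemma ln2_ge : 1 / 2 <= ln 2 :> R.
Proof.
have := @ln_le_sub1 2^-1; rewrite lnV ?posrE ?ltr0n // => /(_ _) h.
have : - ln 2 <= 2^-1 - 1 :> R by apply: h; rewrite invr_gt0 ltr0n.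
lra.
Qed.

Lemma small_geometric (s eps : R) : 0 < s -> s < 1 -> 0 < eps ->
  exists J, s ^+ J / (1 - s) <= eps.
Proof.
move=> s0 s1 e0; pose c := 1 - s; have c0 : 0 < c by rewrite /c; lra.
pose J := (Num.truncn (eps^-1 / c / c)).+1; exists J.
have hJ : eps^-1 / c / c <= J%:R by apply/ltW/truncnS_gt.
have J0 : 0 < J%:R :> R by rewrite ltr0n.
have h : s ^+ J <= expR (- (c * J%:R)).
  apply: (@le_trans _ _ (expR (- c) ^+ J)).
    rewrite lerXn2r ?nnegrE ?expR_ge0 ?(ltW s0) //.
    by apply: le_trans (expR_ge1Dx _); rewrite /c; lra.
  by rewrite -expRM_natl mulrN mulrC.
have h2 : expR (- (c * J%:R)) <= (c * J%:R)^-1.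
  rewrite expRN lef_pV2 ?posrE ?expR_gt0 ?mulr_gt0 //.
  by apply: le_trans (expR_ge1Dx _); lra.
rewrite ler_pdivrMr //; apply: le_trans h _; apply: le_trans h2 _.
rewrite -[leRHS]invrK lef_pV2 ?posrE ?invr_gt0 ?mulr_gt0 // invfM.
move: hJ; rewrite ler_pdivrMr // ler_pdivrMr // => hJ.
rewrite ler_pdivrMr //.
by apply: le_trans hJ _; rewrite mulrC mulrA.
Qed.

Lemma ln_nat_le (a b : nat) : (0 < a)%N -> (a <= b)%N -> ln a%:R <= ln b%:R :> R.
Proof.
by move=> a0 ab; rewrite ler_ln ?posrE ?ltr0n ?ler_nat ?(leq_trans a0).
Qed.

Lemma trunc_log_le_ln (Y : nat) : (0 < Y)%N ->
  (trunc_log 2 Y)%:R * ln 2 <= ln Y%:R :> R.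
Proof.
move=> Y0; have := trunc_logP (isT : 1 < 2)%N Y0 => h.
have := ln_nat_le (expn_gt0 2 _ : (0 < 2 ^ trunc_log 2 Y)%N) h.
by rewrite natrX lnXn ?ltr0n // mulr_natl.
Qed.

Lemma nat_ge_of_ln (a b : nat) : (0 < b)%N -> ln a%:R <= ln b%:R :> R -> (a <= b)%N.
Proof.
move=> b0; case: a => // a; rewrite ler_ln ?posrE ?ltr0n // ler_nat.
by [].
Qed.

Lemma min_power_gt (F Y : nat) : (1 < Y)%N -> (1 < F)%N ->
  exists r, [/\ (0 < r)%N, (F ^ 3 <= Y ^ r)%N & (Y ^ r.-1 <= F ^ 3)%N].
Proof.
move=> Y1 F1; have ex : exists r, (F ^ 3 <= Y ^ r)%N.
  by exists (F ^ 3)%N; apply/ltnW/ltn_expl.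
case: (ex_minnP ex) => r hr rmin; exists r.
have r0 : (0 < r)%N.
  case: r hr {rmin} => //; rewrite expn0 leqNgt.
  by rewrite -(exp1n 3) ltn_exp2r // F1.
split => //; apply: ltnW; rewrite ltnNge; apply/negP => /rmin; lia.
Qed.

(** The main term r w of the energy cancels against Y^r, so ln T is at most a small share of r w,
    while r w is at most about 4 ln F. *)
Lemma exceptional_sparse : exists u0 : R, forall u (Y E F : nat), u0 <= u ->
  (0 < Y)%N -> (0 < E)%N -> (0 < F)%N -> (34 / 10) * u <= ln Y%:R ->
  ln E%:R <= ln Y%:R / 100 :> R -> (Y <= E * F)%N -> ln F%:R <= u ^+ 2 + 1 ->
  (#|[set f : 'I_F.+1 | `[< exceptional Y E f >]]| ^ 2 <= F)%N.
Proof.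
(* This gives ln(1/s) <= 1/63; J is then chosen to make the geometric tail at most 1/100. *)
pose s : R := 63 / 64; have s0 : 0 < s by rewrite /s; lra.
have s1 : s < 1 by rewrite /s; lra.
have [|J hJ] := @small_geometric s (1 / 100) s0 s1; first lra.
set del := s ^+ J / (1 - s) in hJ.
have del0 : 0 <= del by rewrite divr_ge0 ?exprn_ge0 ?(ltW s0) // subr_ge0 ltW.
pose z : R := (2 ^ J).+1%:R.
have z0 : 0 < z by rewrite ltr0n.
(* The square ensures 400 z <= sqrt w, so the logarithm of the number of smooth parts, at most 4 z
   sqrt w, stays below w/100. *)
exists (1 + 100 + (4 * (100 * z)) ^+ 2) => u Y E F hu Y0 E0 F0 hw hE YEF hF.
set w := ln Y%:R in hw hE *.
have zz : 0 <= (4 * (100 * z)) ^+ 2 by rewrite sqr_ge0.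
have u1 : 101 <= u by lra.
have w1 : 3 * 100 <= w by lra.
have wz : (4 * (100 * z)) ^+ 2 <= w by lra.
have Y1 : (1 < Y)%N.
  rewrite ltnNge; apply/negP => Y1; have e : Y = 1%N by apply/eqP; rewrite eqn_leq Y1.
  by move: w1; rewrite /w e ln1; lra.
have lF : w <= ln E%:R + ln F%:R.
  have := ln_nat_le Y0 YEF; rewrite natrM lnM ?posrE ?ltr0n //.
have F1 : (1 < F)%N.
  rewrite ltnNge; apply/negP => F1; have e : F = 1%N by apply/eqP; rewrite eqn_leq F1.
  by move: lF; rewrite e ln1; lra.
have [r [r0 hr1 hr2]] := min_power_gt Y1 F1.
set lnF := ln F%:R in lF hF.
have rw : r%:R * w <= 3 * lnF + w.
  have -> : r%:R = r.-1%:R + 1 :> R by rewrite natr1 prednK.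
  rewrite mulrDl mul1r lerD2r mulr_natl mulr_natl -!lnXn ?ltr0n // -!natrX.
  by apply: ln_nat_le; rewrite ?expn_gt0 ?Y0.
set l := trunc_log 2 Y.
pose bd : R := ((l.+1 ^ (2 ^ J).+1) ^ (2 * r))%:R * ((2 / s) ^+ l * (1 + del) ^+ r) ^+ r.
have bd0 : 0 < bd.
  rewrite mulr_gt0 ?ltr0n ?expn_gt0 // exprn_gt0 // mulr_gt0 // exprn_gt0 //.
    by rewrite divr_gt0.
  by lra.
have hQ t : (t <= Y)%N -> (nsol t r <= Num.truncn bd)%N.
  by move=> tY; rewrite truncn_ge_nat ?(ltW bd0) // nsol_le.
have := exceptional_count E Y0 F0 hr1 hQ; set T := #|_| => hT.
have [-> //|T0] := posnP T.
have lnT : ln T%:R + r%:R * w <= ln 4 + (2 * r).+1%:R * ln E%:R + ln bd.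
  have : (T * Y ^ r)%:R <= 4 * E%:R ^+ (2 * r).+1 * bd.
    apply: (@le_trans _ _ (4 * E ^ (2 * r).+1 * Num.truncn bd)%:R).
      by rewrite ler_nat.
    rewrite !natrM natrX ler_wpM2l ?mulr_ge0 ?exprn_ge0 ?ler0n //.
    by rewrite truncn_le ltW.
  have E0' : 0 < E%:R :> R by rewrite ltr0n.
  have T0' : 0 < T%:R :> R by rewrite ltr0n.
  have Y0' : 0 < Y%:R :> R by rewrite ltr0n.
  have p4 : 0 < 4 :> R by [].
  have YR : 0 < Y%:R ^+ r :> R by rewrite exprn_gt0.
  have ER : 0 < E%:R ^+ (2 * r).+1 :> R by rewrite exprn_gt0.
  have P4 := mulr_gt0 p4 ER.
  rewrite natrM natrX => le; have := le; rewrite -ler_ln ?posrE ?(mulr_gt0 T0' YR) ?(mulr_gt0 P4 bd0) //.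
  rewrite (lnM T0' YR) (lnM P4 bd0) (lnM p4 ER) !lnXn // -/w.
  by rewrite -[w *+ r]mulr_natl -[ln E%:R *+ _]mulr_natl.
have l2 : l%:R <= 2 * w.
  have := trunc_log_le_ln Y0; rewrite -/l -/w; have := ln2_ge.
  have : 0 <= l%:R :> R by []; move: (l%:R) (ln 2) => x y; nra.
have lnbd : ln bd <= (2 * r%:R) * (w / 100) +
    r%:R * (w + 2 * w / 63 + r%:R / 100).
  have p1 : 0 < l.+1%:R :> R by rewrite ltr0n.
  have p2 : 0 < 2 / s by rewrite divr_gt0.
  have p3 : 0 < 1 + del by lra.
  rewrite /bd lnM ?posrE ?ltr0n ?expn_gt0 ?exprn_gt0 ?mulr_gt0 ?exprn_gt0 //.
  apply: lerD.
    rewrite !natrX !lnXn ?exprn_gt0 // -[X in X <= _]mulr_natl natrM.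
    rewrite ler_wpM2l ?mulr_ge0 // -[ln _ *+ _]mulr_natl -/z.
    (* ln t <= 2 sqrt t *)
    have sq : ln l.+1%:R <= 4 * Num.sqrt w.
      have q0 : 0 < Num.sqrt (4 * w) by rewrite sqrtr_gt0; lra.
      have : ln l.+1%:R <= ln (Num.sqrt (4 * w) ^+ 2).
        rewrite ler_ln ?posrE ?exprn_gt0 // sqr_sqrtr; last lra.
        rewrite -natr1; lra.
      move/le_trans; apply; rewrite lnXn // -[ln _ *+ 2]mulr_natl.
      have := ln_sublinear q0; rewrite sqrtrM; last lra.
      have -> : Num.sqrt (4 : R) = 2 by rewrite -[4](_ : 2 ^+ 2 = _) ?sqrtr_sqr ?ger0_norm //; lra.
      lra.
    have sw : 4 * (100 * z) <= Num.sqrt w.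
      rewrite -[leLHS]ger0_norm ?mulr_ge0 ?(ltW z0) // -sqrtr_sqr ler_sqrt //; lra.
    have sww : Num.sqrt w * Num.sqrt w = w by rewrite -expr2 sqr_sqrtr //; lra.
    apply: le_trans (ler_wpM2l (ltW z0) sq) _.
    rewrite -{2}sww; nra.
  rewrite lnXn ?mulr_gt0 ?exprn_gt0 // -[X in X <= _]mulr_natl.
  rewrite ler_wpM2l // lnM ?posrE ?exprn_gt0 // !lnXn // -[ln _ *+ l]mulr_natl -[ln _ *+ r]mulr_natl; apply: lerD.
    rewrite lnM ?posrE ?invr_gt0 // mulrDr; apply: lerD; first exact: trunc_log_le_ln.
    have h : ln s^-1 <= 1 / 63.
      by apply: le_trans (ln_le_sub1 _) _; rewrite ?invr_gt0 // /s; lra.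
    have : 0 <= l%:R :> R by [].
    move: h l2; move: (l%:R) (ln s^-1) => x y; nra.
  have h : ln (1 + del) <= 1 / 100.
    by apply: le_trans (ln_le_sub1 p3) _; lra.
  have : 0 <= r%:R :> R by []; move: h; move: (r%:R) (ln _) => x y; nra.
have r1 : 1 <= r%:R :> R by rewrite ler1n.
(* (r - 1) w <= 3 ln F <= 3 (u^2 + 1) <= w^2, since w >= 3.4 u. *)
have rle : r%:R <= 1 + w.
  have h3 : (r%:R - 1) * w <= w * w.
    rewrite mulrBl mul1r lerBlDr; apply: le_trans rw _; rewrite lerD2r.
    apply: (@le_trans _ _ (3 * (u ^+ 2 + 1))); first by rewrite ler_wpM2l.
    rewrite expr2; nra.
  by move: h3; rewrite ler_pM2r; lra.
have ln4 : ln 4 <= 3 :> R by apply: le_trans (ln_le_sub1 _) _; lra.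
rewrite (@nat_ge_of_ln _ F) // natrX lnXn ?ltr0n // -[ln _ *+ 2]mulr_natl -/lnF.
have e2r : (2 * r).+1%:R = 2 * r%:R + 1 :> R by rewrite -natr1 natrM.
(* Shares of r w: 3/100 from the powers of E, 2/100 from the smooth parts, 2/63 from Rankin's
   weight, 2/100 from (1 + del)^(r^2), and 1/100 from the factor 4. *)
have hT2 : ln T%:R <= r%:R * w * (12 / 100).
  have b1 : (2 * r).+1%:R * ln E%:R <= (3 * r%:R) * (w / 100).
    rewrite e2r; apply: ler_pM => //; try lra.
      by apply: ln_ge0; rewrite ler1n.
  have b2 : r%:R * (r%:R / 100) <= r%:R * (2 * w / 100) by rewrite ler_wpM2l //; lra.
  have b3 : 3 * 100 <= r%:R * w by nra.
  have e1 : 2 * r%:R * (w / 100) + r%:R * (w + 2 * w / 63 + r%:R / 100) =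
      r%:R * w * (2 / 100) + r%:R * w * (1 + 2 / 63) + r%:R * (r%:R / 100) by field.
  rewrite e1 in lnbd.
  have e2 : 3 * r%:R * (w / 100) = r%:R * w * (3 / 100) by field.
  have e3 : r%:R * (2 * w / 100) = r%:R * w * (2 / 100) by field.
  move: lnT lnbd b1 b2 b3 ln4; rewrite e2 e3.
  move: (r%:R * w) (r%:R * (r%:R / 100)) ((2 * r).+1%:R * ln E%:R) (ln bd) (ln T%:R) (ln 4).
  by clear => *; lra.
(* Here w <= (100/99) ln F, so r w <= 4.02 ln F, and twice 12/100 of it is below ln F. *)
have fin (p q e v f : R) : 0 <= v -> q <= p * (12 / 100) -> p <= 3 * f + v -> v <= e + f ->
    e <= v / 100 -> 2 * q <= f by clear => *; lra.
have w0 : 0 <= w by rewrite (le_trans _ w1).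
exact: fin w0 hT2 rw lF hE.
Qed.

End Sparsity.

(** * Exceptional moduli *)

Section Counting.
Variable R : realType.

Lemma harmonic_le (N : nat) : (0 < N)%N ->
  \sum_(1 <= i < N.+1) i%:R^-1 <= 1 + ln N%:R :> R.
Proof.
case: N => // N _; elim: N => [|N IH]; first by rewrite big_nat1 invr1 ln1 addr0.
rewrite big_nat_recr //=; apply: le_trans (lerD IH (lexx _)) _.
have p1 : 0 < N.+1%:R :> R by rewrite ltr0n.
have p2 : 0 < N.+2%:R :> R by rewrite ltr0n.
have := ln_le_sub1 (divr_gt0 p1 p2); rewrite ln_div ?posrE //.
have -> : N.+1%:R / N.+2%:R - 1 = - N.+2%:R^-1 :> R.
  by rewrite -[N.+2%:R]natr1 in p2 *; field; rewrite gt_eqF.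
by move: (ln _) (ln _) (_^-1) => x y z *; lra.
Qed.

(** Entries up to m = size + 1 are distinct and bounded by the harmonic sum; the fewer than m larger
    ones contribute at most 1/m each. *)
Lemma sum_inv_uniq_le (Q : seq nat) : uniq Q -> (forall q, q \in Q -> (0 < q)%N) ->
  \sum_(q <- Q) q%:R^-1 <= 2 + ln (size Q).+1%:R :> R.
Proof.
move=> uQ Q0; set m := (size Q).+1; have m0 : 0 < m%:R :> R by rewrite ltr0n.
rewrite (bigID (fun q => q <= m)%N) /=.
have h1 : \sum_(q <- Q | (q <= m)%N) q%:R^-1 <= \sum_(1 <= i < m.+1) i%:R^-1 :> R.
  rewrite -big_filter.
  have pe : perm_eq [seq q <- Q | (q <= m)%N] [seq i <- index_iota 1 m.+1 | i \in Q].
    apply: uniq_perm; rewrite ?filter_uniq ?iota_uniq // => q.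
    rewrite !mem_filter mem_index_iota ltnS.
    by case: (boolP (q \in Q)) => [/Q0 ->|_]; rewrite ?andbF ?andbT.
  rewrite (perm_big _ pe) big_filter big_mkcond; apply: ler_sum => i _.
  by case: ifP => // _; rewrite invr_ge0.
have h2 : \sum_(q <- Q | ~~ (q <= m)%N) q%:R^-1 <= 1 :> R.
  apply: (@le_trans _ _ (\sum_(q <- Q) m%:R^-1)).
    rewrite big_mkcond; apply: ler_sum => q _; case: ifP => [|_]; last by rewrite invr_ge0.
    by rewrite -ltnNge => lt; rewrite lef_pV2 ?posrE ?ltr0n ?(leq_trans _ lt) // ler_nat ltnW.
  rewrite big_const_seq count_predT iter_addr addr0 -[_ *+ size Q]mulr_natr mulrC.
  by rewrite ler_pdivrMr // mul1r ler_nat.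
have := @harmonic_le m isT; move: h1 h2; move: (\sum_(1 <= i < _) _) (ln _).
by move: (\sum_(q <- Q | _) _) (\sum_(q <- Q | _) _) => *; lra.
Qed.

(** * Squarefree divisors and the mean of 2^omega(n) *)

Fixpoint allprods (s : seq nat) : seq nat :=
  if s is p :: s' then allprods s' ++ [seq (p * d)%N | d <- allprods s'] else [:: 1%N].

Lemma size_allprods s : size (allprods s) = (2 ^ size s)%N.
Proof. by elim: s => //= p s IH; rewrite size_cat size_map IH expnS mul2n addnn. Qed.

Lemma coprime_allprods p s d : prime p -> all prime s -> p \notin s ->
  d \in allprods s -> coprime p d.
Proof.
move=> pp; elim: s d => [|q s IH] d /=.
  by move=> _ _; rewrite inE => /eqP ->; rewrite coprimen1.
case/andP => pq ps; rewrite inE negb_or => /andP[ne ns].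
rewrite mem_cat => /orP[|/mapP[e he ->]]; first exact: IH.
by rewrite coprimeMr (IH _ ps ns he) andbT prime_coprime // dvdn_prime2.
Qed.

Lemma allprods_dvd s d n : all prime s -> uniq s -> all (fun p => p %| n)%N s ->
  d \in allprods s -> (d %| n)%N.
Proof.
elim: s d => [|p s IH] d /=; first by rewrite inE => _ _ _ /eqP ->.
case/andP => pp ps /andP[ns us] /andP[pn sn].
rewrite mem_cat => /orP[|/mapP[e he ->]]; first exact: IH.
by rewrite Gauss_dvd ?(coprime_allprods pp ps ns he) // pn IH.
Qed.

Lemma uniq_allprods s : all prime s -> uniq s -> uniq (allprods s).
Proof.
elim: s => //= p s IH /andP[pp ps] /andP[ns us].
rewrite cat_uniq IH // map_inj_uniq ?IH //; last first.
  by move=> x y /eqP; rewrite eqn_pmul2l ?prime_gt0 // => /eqP.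
rewrite andbT; apply/hasPn => _ /mapP[e he ->]; apply/negP => /(coprime_allprods pp ps ns).
by rewrite coprimeMr prime_coprime // dvdnn.
Qed.

(** The left side is the number of squarefree divisors of [n]. *)
Lemma exp2_primes_le (n X : nat) : (0 < n)%N -> (n <= X)%N ->
  (2 ^ size (primes n) <= \sum_(1 <= k < X.+1 | k %| n) 1)%N.
Proof.
move=> n0 nX; rewrite -size_allprods sum1_count -size_filter.
apply: uniq_leq_size; first by rewrite uniq_allprods ?primes_all_prime ?primes_uniq.
move=> d hd; have dn : (d %| n)%N.
  apply: allprods_dvd hd; rewrite ?primes_all_prime ?primes_uniq //.
  by apply/allP => p; rewrite mem_primes => /and3P[].
rewrite mem_filter dn mem_index_iota ltnS (dvdn_gt0 n0 dn) /=.
exact: leq_trans (dvdn_leq n0 dn) nX.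
Qed.

Lemma count_multiples (k X : nat) : (0 < k)%N ->
  \sum_(1 <= n < X.+1 | (k %| n)%N) 1 <= X%:R * k%:R^-1 :> R.
Proof.
move=> k0; rewrite sum_multiples // big_const_nat iter_addr addr0 subSS subn0.
by rewrite ler_pdivlMr ?ltr0n // -natrM ler_nat leq_trunc_div.
Qed.

Lemma sum_exp2_primes_le (X : nat) : (0 < X)%N ->
  \sum_(1 <= n < X.+1) 2 ^+ size (primes n) <= X%:R * (1 + ln X%:R) :> R.
Proof.
move=> X0; apply: (@le_trans _ _ (\sum_(1 <= n < X.+1) \sum_(1 <= k < X.+1 | (k %| n)%N) 1)).
  apply: ler_sum_nat => n /andP[n0 nX].
  by have := exp2_primes_le n0 nX; rewrite -(ler_nat R) natrX natr_sum.
under eq_bigr do rewrite big_mkcond.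
rewrite exchange_big /=.
apply: (@le_trans _ _ (\sum_(1 <= k < X.+1) X%:R * k%:R^-1)).
  by apply: ler_sum_nat => k /andP[k0 _]; rewrite -big_mkcond; apply: count_multiples.
by rewrite -mulr_sumr ler_wpM2l // harmonic_le.
Qed.

(** At most X/f integers up to X are multiples of f, so the sum of 1/f over exceptional f is needed;
    each of its dyadic blocks contributes at most 2 rho. *)
Lemma exceptional_moduli_le (Y E X : nat) (rho : R) : (0 < Y)%N -> (0 < X)%N ->
  0 <= rho -> E%:R <= rho ^+ 2 * Y%:R ->
  (forall F, (0 < F)%N -> (F <= 2 * X)%N -> (Y <= E * F)%N ->
    (#|[set f : 'I_F.+1 | `[< exceptional Y E f >]]| ^ 2 <= F)%N) ->
  \sum_(1 <= n < X.+1 | `[< exists2 f, (f %| n)%N & exceptional Y E f >]) 1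
    <= X%:R * ((trunc_log 2 X).+1%:R * (2 * rho)).
Proof.
move=> Y0 X0 r0 EY sparse.
pose ex f := `[< exceptional Y E f >].
pose T F := #|[set f : 'I_F.+1 | ex f]|.
(* If some f <= F is exceptional, then F >= Y/E >= rho^(-2), so sqrt F <= rho F; otherwise the count
   is 0. *)
have T_le F : (0 < F)%N -> (F <= 2 * X)%N -> (T F)%:R <= rho * F%:R.
  move=> F0 FX; case: (posnP (T F)) => [->|]; first by rewrite mulr_ge0.
  case/card_gt0P => f; rewrite inE => /asboolP/exceptional_ge YEf.
  have YEF : (Y <= E * F)%N by rewrite (leq_trans YEf) // leq_mul2l -ltnS ltn_ord orbT.
  have F0' : 0 < F%:R :> R by rewrite ltr0n.
  have Y0' : 0 < Y%:R :> R by rewrite ltr0n.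
  have h : (T F)%:R ^+ 2 <= (rho * F%:R) ^+ 2.
    apply: (@le_trans _ _ F%:R); first by rewrite -natrX ler_nat sparse.
    have h1 : Y%:R <= E%:R * F%:R :> R by rewrite -natrM ler_nat.
    rewrite -(ler_pM2r Y0'); apply: le_trans (ler_wpM2l (ltW F0') h1) _.
    have -> : (rho * F%:R) ^+ 2 * Y%:R = F%:R * (rho ^+ 2 * Y%:R * F%:R) by ring.
    by rewrite ler_pM2l // ler_pM2r.
  by rewrite -(ler_pXn2r (n := 2)) ?nnegrE ?mulr_ge0.
have inv_sum : \sum_(1 <= f < X.+1 | ex f) f%:R^-1 <= (trunc_log 2 X).+1%:R * (2 * rho).
  pose l := trunc_log 2 X.
  apply: (@le_trans _ _ (\sum_(1 <= f < X.+1 | ex f) \sum_(j < l.+1 | j == trunc_log 2 f :> nat) f%:R^-1)).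
    rewrite big_nat_cond [leRHS]big_nat_cond; apply: ler_sum => f /andP[/andP[f0 fX] _].
    have lt : (trunc_log 2 f < l.+1)%N by rewrite ltnS leq_trunc_log.
    by rewrite (big_pred1 (Ordinal lt)).
  under eq_bigr do rewrite big_mkcond.
  rewrite exchange_big /=.
  apply: (@le_trans _ _ (\sum_(j < l.+1) 2 * rho)); last first.
    by rewrite sumr_const card_ord -[leLHS]mulr_natl.
  apply: ler_sum => j _; pose F := (2 ^ j.+1)%N.
  have jX : (2 ^ j <= X)%N.
    by apply: leq_trans (trunc_logP (isT : 1 < 2)%N X0); rewrite leq_exp2l // -ltnS.
  have p0 : 0 < (2 ^ j)%:R :> R by rewrite ltr0n expn_gt0.
  have TF : (T F)%:R <= rho * F%:R.
    by apply: T_le; rewrite /F ?expn_gt0 // expnS leq_mul2l jX orbT.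
  apply: (@le_trans _ _ ((T F)%:R * (2 ^ j)%:R^-1)); last first.
    by rewrite ler_pdivrMr //; apply: le_trans TF _; rewrite /F expnS natrM mulrA (mulrC rho).
  have -> : (T F)%:R * (2 ^ j)%:R^-1 = \sum_(0 <= f < F.+1 | ex f) (2 ^ j)%:R^-1 :> R.
    rewrite big_mkord sumr_const mulr_natl; congr (_ *+ _); apply: eq_card => f.
    by rewrite inE.
  have term f : (0 < f)%N -> (f <= X)%N -> j == trunc_log 2 f :> nat ->
      f%:R^-1 <= (2 ^ j)%:R^-1 :> R /\ (f < F)%N.
    move=> f0 fX /eqP e; split; last by rewrite /F e trunc_log_ltn.
    by rewrite lef_pV2 ?posrE ?ltr0n ?expn_gt0 // ler_nat e trunc_logP.
  pose g f : R := if ex f && (j == trunc_log 2 f :> nat) && (0 < f <= X)%N then (2 ^ j)%:R^-1 else 0.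
  apply: (@le_trans _ _ (\sum_(0 <= f < (X + F).+1) g f)).
    rewrite [leRHS](@big_cat_nat _ _ _ X.+1) //=; last by rewrite ltnS leq_addr.
    rewrite -[leLHS]addr0; apply: lerD; last first.
      by apply: sumr_ge0 => f _; rewrite /g; case: ifP; rewrite ?invr_ge0.
    rewrite [leRHS]big_ltn // -[leLHS]add0r; apply: lerD.
      by rewrite /g ltnn andbF.
    rewrite big_mkcond; apply: ler_sum_nat => f /andP[f0 fX].
    rewrite /g f0 -ltnS fX andbT; case: (ex f) => //=.
    by case: ifP => // e; case: (term f f0 fX e).
  rewrite (@big_cat_nat _ _ _ F.+1) //=; last by rewrite ltnS leq_addl.
  rewrite -[leRHS]addr0; apply: lerD.
    rewrite [leRHS]big_mkcond; apply: ler_sum_nat => f _; rewrite /g.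
    by case: (ex f) => //=; case: ifP; rewrite ?invr_ge0.
  rewrite big_nat_cond big1 // => f /andP[/andP[Ff _] _]; rewrite /g.
  case: ifP => // /andP[/andP[_ e] /andP[f0 fX]].
  have [_] := term f f0 fX e; by rewrite ltnNge (ltnW Ff).
apply: (@le_trans _ _ (\sum_(1 <= n < X.+1) \sum_(1 <= f < X.+1 | ex f) (f %| n)%:R)).
  rewrite big_mkcond; apply: ler_sum_nat => n /andP[n0 nX].
  case: asboolP => [[f fn ef]|_]; last by apply: sumr_ge0.
  have f0 := dvdn_gt0 n0 fn.
  rewrite big_mkcond (bigD1_seq f) ?iota_uniq ?mem_index_iota ?f0 //=; last first.
    by rewrite ltnS; apply: leq_trans (dvdn_leq n0 fn) _.
  rewrite fn (_ : ex f); last exact/asboolP.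
  by rewrite lerDl; apply: sumr_ge0 => g _; case: ifP.
rewrite exchange_big /=.
apply: (@le_trans _ _ (\sum_(1 <= f < X.+1 | ex f) X%:R * f%:R^-1)).
  rewrite big_nat_cond [leRHS]big_nat_cond; apply: ler_sum => f /andP[/andP[f0 _] _].
  apply: le_trans (count_multiples X f0); rewrite [leRHS]big_mkcond.
  by apply: ler_sum => n _; case: (f %| n)%N.
by rewrite -mulr_sumr ler_wpM2l.
Qed.

End Counting.

(** * The error term *)

Lemma carmichael_le (n : nat) : (1 < n)%N -> (carmichael n <= n)%N.
Proof.
move=> n1; apply: leq_trans (card_units_le n1).
exact: dvdn_leq (cardG_gt0 _) (carmichael_dvd_card n1).
Qed.

Lemma exp2_size_primes_le (n : nat) : (0 < n)%N -> (2 ^ size (primes n) <= n)%N.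
Proof.
move=> n0; apply: leq_trans (exp2_primes_le n0 (leqnn n)) _.
rewrite big_mkcond /=; apply: (@leq_trans (\sum_(1 <= k < n.+1) 1)%N).
  by apply: leq_sum => k _; case: ifP.
by rewrite sum_nat_const_nat muln1 subSS subn0.
Qed.

Lemma leq_expn_fact m j : (m ^ j <= (m + j)`!)%N.
Proof.
elim: j => [|j IH]; first by rewrite expn0 fact_gt0.
by rewrite expnS addnS factS leq_mul // leqW // leq_addr.
Qed.

Section ErrorTerm.
Variable R : realType.
Implicit Types u x y : R.

Lemma ln_nat_trunc_log (X : nat) : (0 < X)%N -> (trunc_log 2 X)%:R <= 2 * ln X%:R :> R.
Proof.
move=> X0; have := trunc_log_le_ln R X0; have := ln2_ge R.
have : 0 <= (trunc_log 2 X)%:R :> R by [].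
by move: (_%:R) (ln _) (ln _) => a b c *; nra.
Qed.

(* Everything is measured against a = u^(1/32), for which ln u <= 32 a. *)
Lemma truncation_level : exists u0 : R, forall u, u0 <= u -> exists m : nat,
  (forall N : nat, N%:R <= 2 * u ^+ 2 -> N.+1%:R ^+ (2 * m) <= expR (u / 64)) /\
  (forall Q : seq nat, uniq Q -> (forall q, q \in Q -> (0 < q)%N) ->
     (size Q)%:R <= 2 * u ^+ 2 ->
     \sum_(d <- subprods Q (2 * m)) d%:R^-1 <= expR (- (u / (16 * 100)))).
Proof.
(* It forces a >= 100, enough for comparisons such as 2 + 96 a <= a^2. *)
exists ((100 : R) ^+ 32) => u hu.
have c1 : 1 <= (100 : R) by rewrite ler1n.
have u0 : 0 < u by apply: lt_le_trans hu; rewrite exprn_gt0 // ltr0n.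
pose L := ln u; pose a := expR (L / 32).
have aE : a ^+ 32 = u.
  by rewrite -expRM_natl mulrC divfK ?pnatr_eq0 // lnK.
have a0 : 0 < a by exact: expR_gt0.
have a100 : 100 <= a.
  by move: hu; rewrite -aE ler_pXn2r ?nnegrE ?(ltW a0) ?ler0n.
have a1 : 1 <= a by apply: le_trans a100.
have La : L <= 32 * a.
  have := expR_ge1Dx (L / 32); rewrite -/a => h.
  by clear -h; lra.
have pw (i j : nat) : (i <= j)%N -> a ^+ i <= a ^+ j by move=> ij; rewrite ler_weXn2l.
have L1 : 1 <= L.
  have e1 : expR 1 <= u.
    apply: (@le_trans _ _ a); last by rewrite -aE -{1}[a]expr1 pw.
    apply: (@le_trans _ _ 4); last by apply: le_trans a100; rewrite ler_nat.
    have h2 : 1 <= ln 4 :> R.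
      have -> : 4 = 2 * 2 :> R by rewrite -natrM.
      by rewrite lnM ?posrE ?ltr0n //; have := ln2_ge R; move: (ln 2) => b *; lra.
    by rewrite -[leRHS](@lnK R) ?posrE ?ltr0n // ler_expR.
  by rewrite -(expRK 1) ler_ln ?posrE ?expR_gt0.
have L0 : 0 < L by apply: lt_le_trans L1.
(* As N + 1 <= u^3, the number of terms is at most exp(6 m ln u) <= exp(6 u / 400) <= exp(u /
   64). *)
pose v := u / (4 * 100 * L); pose m := Num.truncn v.
have d0 : 0 < 4 * 100 * L by rewrite !mulr_gt0 ?ltr0n.
have v0 : 0 <= v by rewrite divr_ge0 ?ltW.
have /andP[mv vm] := truncn_itv v0; rewrite -/m in mv vm.
have vL : v * L = u / (4 * 100).
  by rewrite /v; field; rewrite gt_eqF.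
have mL : m%:R * L <= u / (4 * 100) by rewrite -vL ler_pM2r.
have vbig : a ^+ 28 <= v.
  rewrite ler_pdivlMr // -aE (_ : 32 = 28 + 4)%N // exprD ler_wpM2l ?exprn_ge0 ?(ltW a0) //.
  have h1 : 4 * 100 * L <= 4 * 100 * (32 * a) by rewrite ler_pM2l // mulr_gt0 ?ltr0n.
  apply: le_trans h1 _.
  have k4 : 4 * 32 <= a * a by move: a100; clear -a1; move=> *; nra.
  have -> : 4 * 100 * (32 * a) = (4 * 32) * (100 * a) by ring.
  have -> : a ^+ 4 = (a * a) * (a * a) by ring.
  by rewrite ler_pM ?mulr_ge0 ?ler0n ?(ltW a0) // ler_pM2r.
have mbig : a ^+ 20 <= m%:R.
  have h : v < m%:R + 1 by rewrite natr1.
  have h2 : a ^+ 20 + 1 <= a ^+ 28.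
    have -> : a ^+ 28 = a ^+ 20 * a ^+ 8 by rewrite -exprD.
    have h3 : 1 <= a ^+ 20 by rewrite exprn_ege1.
    have h4 : 2 <= a ^+ 8.
      apply: (@le_trans _ _ a); first by apply: le_trans a100; rewrite ler_nat.
      by rewrite -{1}[a]expr1 pw.
    by move: h3 h4; move: (a ^+ 20) (a ^+ 8); clear => *; nra.
  have fin (p q k w : R) : w < k + 1 -> p + 1 <= q -> q <= w -> p <= k.
    by clear => *; lra.
  exact: fin h h2 vbig.
have m0 : (0 < m)%N.
  by rewrite -(ltr0n R); apply: lt_le_trans mbig; rewrite exprn_gt0.
have lnN (N : nat) : N%:R <= 2 * u ^+ 2 -> ln N.+1%:R <= 3 * L.
  move=> h; have -> : 3 * L = ln (u ^+ 3) by rewrite lnXn // mulr_natl.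
  rewrite ler_ln ?posrE ?ltr0n ?exprn_gt0 //.
  have u3 : 3 <= u.
    by rewrite -aE; apply: le_trans (_ : a <= _); [apply: le_trans a100; rewrite ler_nat|rewrite -{1}[a]expr1 pw].
  rewrite -natr1; move: h u3; rewrite !exprS expr0; move: (N%:R); clear => *; nra.
exists m; split.
  move=> N hN; have := lnN N hN => hl.
  rewrite -[leLHS](@lnK R) ?posrE ?exprn_gt0 ?ltr0n // ler_expR lnXn ?ltr0n //.
  rewrite -[_ *+ (2 * m)]mulr_natl natrM.
  have m0' : 0 <= m%:R :> R by [].
  have h1 : 2 * m%:R * ln N.+1%:R <= 2 * m%:R * (3 * L) by rewrite ler_wpM2l ?mulr_ge0.
  apply: le_trans h1 _; have -> : 2 * m%:R * (3 * L) = 6 * (m%:R * L) by ring.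
  by move: mL u0; move: (m%:R * L); clear => *; lra.
move=> Q uQ Q0 hQ.
apply: le_trans (sum_inv_subprods _ _ _) _.
set S := \sum_(q <- Q) _.
have S0 : 0 <= S by apply: sumr_ge0 => q _; rewrite invr_ge0.
have SA : S <= a ^+ 2.
  have := sum_inv_uniq_le R uQ Q0; have := lnN _ hQ; rewrite -/S expr2.
  move=> h1 h2; have fin (l b c d : R) : d <= 32 * b -> 100 <= b -> l <= 3 * d ->
      c <= 2 + l -> c <= b * b by clear => *; nra.
  exact: fin La a100 h1 h2.
have m0' : 0 < m%:R :> R by rewrite ltr0n.
(* Truncating at 2m primes allows this elementary bound in place of Stirling's formula. *)
have fm : (m%:R ^+ m : R) <= ((2 * m)`!)%:R.
  by rewrite -natrX ler_nat mul2n -addnn leq_expn_fact.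
apply: (@le_trans _ _ ((S ^+ 2 / m%:R) ^+ m)).
  rewrite expr_div_n -exprM ler_wpM2l ?exprn_ge0 //.
  by rewrite lef_pV2 ?posrE ?exprn_gt0 ?ltr0n ?fact_gt0.
(* S^2 <= a^4 and m >= a^20 leave a^(-16) = u^(-1/2), whose m-th power is exp(-m ln u / 2). *)
have q1 : S ^+ 2 / m%:R <= expR (- (L / 2)).
  have -> : expR (- (L / 2)) = (a ^+ 16)^-1.
    rewrite expRN -expRM_natl; congr (expR _)^-1.
    by field.
  rewrite ler_pdivrMr // mulrC ler_pdivlMr ?exprn_gt0 //.
  apply: le_trans mbig.
  have -> : a ^+ 20 = (a ^+ 2) ^+ 2 * a ^+ 16 by rewrite -exprM -exprD.
  by rewrite ler_pM2r ?exprn_gt0 // lerXn2r ?nnegrE ?exprn_ge0 ?(ltW a0).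
apply: (@le_trans _ _ (expR (- (L / 2)) ^+ m)).
  by rewrite lerXn2r ?nnegrE ?expR_ge0 // divr_ge0 ?exprn_ge0.
rewrite -expRM_natl ler_expR.
have Lu : L <= u / (8 * 100).
  apply: le_trans La _; rewrite ler_pdivlMr ?mulr_gt0 ?ltr0n //.
  apply: (@le_trans _ _ (a ^+ 4)); last by rewrite -aE pw.
  have -> : 32 * a * (8 * 100) = (32 * 8) * (100 * a) by ring.
  have -> : a ^+ 4 = (a * a) * (a * a) by ring.
  have k : 32 * 8 <= a * a by move: a100; clear -a1; move=> *; nra.
  by rewrite ler_pM ?mulr_ge0 ?ler0n ?(ltW a0) // ler_pM2r.
have mL2 : u / (4 * 100) - L <= m%:R * L.
  by rewrite -vL lerBlDr -{3}(mul1r L) -mulrDl natr1 ler_pM2r // ltW.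
have -> : m%:R * - (L / 2) = - (m%:R * L / 2) by field.
have fin (p l w : R) : l <= w / (8 * 100) -> w / (4 * 100) - l <= p ->
    - (p / 2) <= - (w / (16 * 100)) by clear => *; lra.
exact: fin Lu mL2.
Qed.
(** Half of the final exponential saving is spent on the polynomial factor, by exp(t) >= 1 +
    t^2/2. *)
Lemma poly_expR_le (c u : R) : 0 < c -> 0 <= u ->
  (1 + u ^+ 2) * expR (- (u / c)) <= 1 + 2 * c ^+ 2.
Proof.
move=> c0 u0; set t := u / c; have t0 : 0 <= t by rewrite divr_ge0 // ltW.
have ut : u = t * c by rewrite divfK // gt_eqF.
have := @expR_ge1Dxn R t 1 t0; rewrite expRN -[2`!]/2%N => h.
have e0 := expR_gt0 t.
rewrite ler_pdivrMr // ut exprMn.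
have c2 : 0 <= c ^+ 2 by rewrite sqr_ge0.
have h2 : t ^+ 2 * c ^+ 2 <= 2 * c ^+ 2 * expR t.
  have -> : 2 * c ^+ 2 * expR t = c ^+ 2 * (2 * expR t) by ring.
  rewrite mulrC ler_wpM2l //.
  by move: h; move: (expR t) (t ^+ 2); clear => *; lra.
have h1 : 1 <= expR t by rewrite -expR0 ler_expR.
by rewrite mulrDl mul1r lerD.
Qed.

(** The character error has exponent u/64 + u/100 - u/32, which is below -u/1600, the exponent of
    the truncation tail. *)
Lemma nonexceptional_error (n Y E m : nat) (u : R) : (1 < n)%N -> 0 <= u ->
  (forall f, (f %| n)%N -> ~ exceptional Y E f) ->
  (size (primes (carmichael n)))%:R <= 2 * u ^+ 2 ->
  (forall N : nat, N%:R <= 2 * u ^+ 2 -> N.+1%:R ^+ (2 * m) <= expR (u / 64)) ->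
  (forall Q : seq nat, uniq Q -> (forall q, q \in Q -> (0 < q)%N) ->
     (size Q)%:R <= 2 * u ^+ 2 ->
     \sum_(d <- subprods Q (2 * m)) d%:R^-1 <= expR (- (u / (16 * 100)))) ->
  2 ^+ size (primes n) <= expR (u / 100) -> expR (u / 32) <= E%:R ->
  `|(\sum_(1 <= a < Y.+1 | lprim n a) 1) - Y%:R * ((Rcount n)%:R / n%:R)|
  <= Y%:R * (3 * expR (- (u / (16 * 100)))) + expR (u / 100).
Proof.
move=> n1 u0 nex sQ h1 h2 hW hE.
have E0 : (0 < E)%N by rewrite -(ltr0n R); apply: lt_le_trans hE; exact: expR_gt0.
apply: le_trans (count_lprim_le R n1 (2 * m) E0 nex) _.
set W := 2 ^+ size (primes n) in hW *.
apply: lerD => //.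
have -> : Y%:R * (3 * expR (- (u / (16 * 100)))) =
   Y%:R * expR (- (u / (16 * 100))) + 2 * Y%:R * expR (- (u / (16 * 100))) by ring.
apply: lerD; last first.
  rewrite ler_wpM2l ?mulr_ge0 //; apply: h2 => //; first exact: primes_uniq.
  by move=> q; rewrite mem_primes => /and3P[/prime_gt0].
apply: (@le_trans _ _ (expR (u / 64) * (expR (u / 100) * Y%:R * expR (- (u / 32))))).
  have W0 : 0 <= W by rewrite exprn_ge0.
  rewrite ler_pM ?exprn_ge0 ?divr_ge0 ?mulr_ge0 // ?h1 //.
  rewrite ler_pM ?mulr_ge0 ?invr_ge0 //; first by rewrite ler_wpM2r.
  by rewrite expRN lef_pV2 ?posrE ?expR_gt0 ?ltr0n.
rewrite mulrA mulrA (mulrAC _ _ (expR (- (u / 32)))) -!expRD mulrC.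
rewrite ler_wpM2l // ler_expR.
by clear -u0; lra.
Qed.

Lemma Ncount_sum (x y : R) :
  \sum_(1 <= a < (Num.truncn y).+1) (Ncount a x)%:R =
  \sum_(1 <= n < (Num.truncn x).+1) \sum_(1 <= a < (Num.truncn y).+1 | lprim n a) 1 :> R.
Proof.
rewrite /Ncount; under eq_bigr do rewrite natr_sum big_mkcond.
by rewrite exchange_big /=; apply: eq_bigr => n _; rewrite -big_mkcond.
Qed.

Lemma count_trivial (n Y : nat) : (0 < n)%N ->
  (`|(\sum_(1 <= a < Y.+1 | lprim n a) 1) - Y%:R * ((Rcount n)%:R / n%:R)| <= Y%:R :> R)
  /\ (0 <= (Rcount n)%:R / n%:R :> R) && ((Rcount n)%:R / n%:R <= 1 :> R).
Proof.
move=> n0; have n0' : 0 < n%:R :> R by rewrite ltr0n.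
have r0 : 0 <= (Rcount n)%:R / n%:R :> R by rewrite divr_ge0.
have r1 : (Rcount n)%:R / n%:R <= 1 :> R.
  rewrite ler_pdivrMr // mul1r ler_nat /Rcount big_mkcond /=.
  apply: (@leq_trans (\sum_(b < n) 1)%N); first by apply: leq_sum => b _; case: ifP.
  by rewrite sum_nat_const card_ord muln1.
split; last by rewrite r0.
have Y0 : 0 <= Y%:R :> R by [].
set A := \sum_(1 <= a < Y.+1 | _) _.
have A0 : 0 <= A by apply: sumr_ge0.
have AY : A <= Y%:R.
  rewrite /A big_mkcond /=.
  apply: (@le_trans _ _ (\sum_(1 <= a < Y.+1) 1)); first by apply: ler_sum => a _; case: ifP.
  by rewrite big_const_nat iter_addr addr0 subSS subn0.
have b0 : 0 <= Y%:R * ((Rcount n)%:R / n%:R) :> R by rewrite mulr_ge0.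
have b1 : Y%:R * ((Rcount n)%:R / n%:R) <= Y%:R :> R by rewrite -[leRHS]mulr1 ler_wpM2l.
by rewrite ler_norml; apply/andP; split; move: A0 AY b0 b1; move: (_ * _) A (Y%:R); clear => *; lra.
Qed.

End ErrorTerm.

(** * Summation over the moduli *)

Theorem theorem1p5 (R : realType) :
  exists c2 : R, 0 < c2 /\
  exists C x0 : R, forall x y : R,
    x0 <= x ->
    expR ((342%:R / 100%:R) * Num.sqrt (ln x)) < y ->
    `| y^-1 * (\sum_(1 <= a < (Num.truncn y).+1) (Ncount a x)%:R)
       - \sum_(1 <= n < (Num.truncn x).+1) (Rcount n)%:R / n%:R |
      <= C * x * expR (- (c2 * Num.sqrt (ln x))).
Proof.
have [u1 sparse] := exceptional_sparse R.
have [u2 level] := truncation_level R.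
(* Twice 1600: one half of exp(-u/1600) absorbs 1 + u^2, the other half is the stated saving. *)
pose c : R := 32 * 100.
have c0 : 0 < c by rewrite mulr_gt0 ?ltr0n.
exists c^-1; split; first by rewrite invr_gt0.
pose u0 : R := `|u1| + `|u2| + 4 * 100.
have u00 : 0 <= u0 by rewrite !addr_ge0 ?mulr_ge0 ?ler0n ?normr_ge0.
(* 11 = 5 + 4 + 1 + 1: generic moduli, moduli with an exceptional divisor, moduli with many primes,
   and n = 1. *)
exists (11 * (1 + 2 * c ^+ 2)), (expR (u0 ^+ 2)) => x y hx hy.
have x0 : 0 < x by apply: lt_le_trans hx; exact: expR_gt0.
set u := Num.sqrt (ln x) in hy *.
have lx : u0 ^+ 2 <= ln x by rewrite -[leLHS]expRK ler_ln ?posrE ?expR_gt0.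
have lx0 : 0 <= ln x by apply: le_trans lx; rewrite sqr_ge0.
have u2E : u ^+ 2 = ln x by rewrite sqr_sqrtr.
have xE : x = expR (u ^+ 2) by rewrite u2E lnK.
have uu : u0 <= u by rewrite -(ger0_norm u00) -sqrtr_sqr ler_sqrt.
have uu1 : u1 <= u.
  apply: le_trans uu; apply: le_trans (ler_norm _) _.
  by rewrite /u0 -addrA lerDl addr_ge0 ?mulr_ge0 ?ler0n.
have uu2 : u2 <= u.
  apply: le_trans uu; apply: le_trans (ler_norm _) _.
  by rewrite /u0 addrAC lerDr addr_ge0 ?mulr_ge0 ?ler0n.
have u400 : 4 * 100 <= u by apply: le_trans uu; rewrite /u0 lerDr addr_ge0.
clear hx lx uu u00; clearbody u; clear u0.
have ug0 : 0 <= u by apply: le_trans u400; rewrite mulr_ge0 ?ler0n.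
have y0 : 0 < y by apply: lt_trans hy; exact: expR_gt0.
set X := Num.truncn x; set Y := Num.truncn y.
have x1 : 1 <= x by rewrite xE -expR0 ler_expR sqr_ge0.
have X0 : (0 < X)%N by rewrite truncn_gt0.
have Xx : X%:R <= x by rewrite truncn_le ltW.
have X0' : 0 < X%:R :> R by rewrite ltr0n.
have lnX : ln X%:R <= u ^+ 2 by rewrite u2E ler_ln.
have Yy : Y%:R <= y by rewrite truncn_le ltW.
(* Rounding [y] down loses less than 1, covered by the surplus exp(0.02 u) of 3.42 over 3.4. *)
have Yge : expR ((34 / 10) * u) <= Y%:R.
  have h : y < Y%:R + 1 by rewrite natr1 truncnS_gt.
  have e : expR (342%:R / 100%:R * u) = expR (34 / 10 * u) * expR (2 / 100 * u).
    by rewrite -expRD; congr expR; field.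
  have h1 := expR_ge1Dx (2 / 100 * u).
  have h2 : 1 <= expR (34 / 10 * u) by rewrite -expR0 ler_expR mulr_ge0 // divr_ge0 ?ler0n.
  move: hy; rewrite e => hy; clear -h hy h1 h2 u400.
  move: (expR (34 / 10 * u)) (expR (2 / 100 * u)) (Y%:R) h hy h1 h2 => a b d h hy h1 h2.
  by nra.
have Y0' : 0 < Y%:R :> R by apply: lt_le_trans Yge; exact: expR_gt0.
have Y0 : (0 < Y)%N by rewrite -(ltr0n R).
have lnY : 34 / 10 * u <= ln Y%:R by rewrite -[leLHS]expRK ler_ln ?posrE ?expR_gt0.
(* ln E has to exceed the costs u/64 + u/100 and stay below ln Y / 100, which is at least 0.034 u;
   u/32 fits once u >= 400. *)
pose E := (Num.truncn (expR (u / 32))).+1.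
have Ege : expR (u / 32) <= E%:R by apply/ltW/truncnS_gt.
have lnE : ln E%:R <= 1 + u / 32.
  have e1 : 1 <= expR (u / 32) by rewrite -expR0 ler_expR divr_ge0.
  have h : E%:R <= 2 * expR (u / 32).
    have -> : E%:R = (Num.truncn (expR (u / 32)))%:R + 1 :> R by rewrite natr1.
    have : (Num.truncn (expR (u / 32)))%:R <= expR (u / 32) by rewrite truncn_le expR_ge0.
    by move=> h0; clear -e1 h0; lra.
  have : ln E%:R <= ln (2 * expR (u / 32)) by rewrite ler_ln ?posrE ?mulr_gt0 ?ltr0n ?expR_gt0.
  rewrite lnM ?posrE ?ltr0n ?expR_gt0 // expRK => /le_trans; apply; rewrite lerD2r.
  by apply: le_trans (ln_le_sub1 _) _; rewrite ?ltr0n //; clear; lra.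
have lnEY : ln E%:R <= ln Y%:R / 100 :> R.
  have fin (e v w : R) : 4 * 100 <= v -> e <= 1 + v / 32 -> 34 / 10 * v <= w -> e <= w / 100.
    by clear => *; lra.
  exact: fin u400 lnE lnY.
pose p := expR (- (u / (16 * 100))); pose q := 1 + u ^+ 2.
have p0 : 0 < p by exact: expR_gt0.
have q1 : 1 <= q by rewrite /q lerDl sqr_ge0.
have [m [lev1 lev2]] := level u uu2.
pose bad n := `[< exists2 f, (f %| n)%N & exceptional Y E f >].
have Nexc : \sum_(1 <= n < X.+1 | bad n) 1 <= 4 * (x * (q * p)).
  (* rho = exp(-u) is admissible because ln Y - ln E >= 0.99 * 3.4 u > 2 u. *)
  have rho0 : 0 <= expR (- u) by exact: expR_ge0.
  have Erho : E%:R <= expR (- u) ^+ 2 * Y%:R.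
    rewrite -expRM_natl -ler_ln ?posrE ?mulr_gt0 ?expR_gt0 ?ltr0n //.
    rewrite lnM ?posrE ?expR_gt0 // expRK.
    have fin (e v w : R) : 0 <= v -> e <= w / 100 -> 34 / 10 * v <= w -> e <= 2 * - v + w.
      by clear => *; lra.
    exact: fin ug0 lnEY lnY.
  have sp F : (0 < F)%N -> (F <= 2 * X)%N -> (Y <= E * F)%N ->
      (#|[set f : 'I_F.+1 | `[< exceptional Y E f >]]| ^ 2 <= F)%N.
    move=> F0 F2X YEF; apply: (sparse u) => //.
    apply: le_trans (ln_nat_le R F0 F2X) _; rewrite natrM lnM ?posrE ?ltr0n //.
    rewrite addrC lerD //.
    by apply: le_trans (ln_le_sub1 _) _; rewrite ?ltr0n //; clear; lra.
  apply: le_trans (exceptional_moduli_le Y0 X0 rho0 Erho sp) _.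
  have tl := ln_nat_trunc_log R X0.
  have ep : expR (- u) <= p by rewrite ler_expR; clear -ug0; lra.
  have -> : 4 * (x * (q * p)) = x * ((2 * q) * (2 * p)) by ring.
  rewrite ler_pM ?mulr_ge0 // ler_pM ?mulr_ge0 // ?ler_pM2l //.
  have -> : (trunc_log 2 X).+1%:R = (trunc_log 2 X)%:R + 1 :> R by rewrite natr1.
  by rewrite /q; clear -tl lnX; lra.
(* Markov's inequality in summed form: the summand is at least 1 whenever 2^omega(n) exceeds
   exp(u/100). *)
have Ndiv : \sum_(1 <= n < X.+1) 2 ^+ size (primes n) * expR (- (u / 100)) <= x * (q * p).
  rewrite -mulr_suml mulrA ler_pM ?expR_ge0 ?sumr_ge0 //; last by rewrite ler_expR; clear -ug0; lra.
  apply: le_trans (sum_exp2_primes_le R X0) _.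
  rewrite ler_pM ?(ltW X0') // ?addr_ge0 ?ln_ge0 ?ler1n //.
  by rewrite /q lerD2l.
pose A n : R := \sum_(1 <= a < Y.+1 | lprim n a) 1.
pose r n : R := (Rcount n)%:R / n%:R.
(* Each summand of the last bracket reaches 1 on a class left to the trivial bound Y; n = 1 is among
   them because the group-theoretic lemmas assume 1 < n. *)
have Dn n : (0 < n)%N -> (n <= X)%N -> `|A n - Y%:R * r n| <=
    Y%:R * (3 * p) + expR (u / 100) +
    Y%:R * ((bad n)%:R + 2 ^+ size (primes n) * expR (- (u / 100)) + (n == 1)%:R).
  move=> n0 nX; have [triv _] := count_trivial R Y n0.
  set b := Y%:R * (3 * p) + _; set W := 2 ^+ size (primes n).
  have b0 : 0 <= b by rewrite addr_ge0 ?mulr_ge0 ?expR_ge0 ?ler0n.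
  have WV : 0 <= W * expR (- (u / 100)) by rewrite mulr_ge0 ?exprn_ge0 ?expR_ge0.
  have big z : 1 <= z -> `|A n - Y%:R * r n| <= b + Y%:R * z.
    move=> z1; apply: le_trans triv _; rewrite -[leLHS]add0r lerD //.
    by rewrite -[leLHS]mulr1 ler_wpM2l.
  case: (boolP (bad n)) => [_|/asboolPn nb].
    by apply: big; rewrite -addrA lerDl addr_ge0.
  case: (eqVneq n 1%N) => [_|n1].
    by apply: big; rewrite lerDr addr_ge0.
  case: (leP W (expR (u / 100))) => [Wle|/ltW Wge]; last first.
    apply: big; rewrite add0r addr0 expRN ler_pdivlMr ?expR_gt0 // mul1r.
    exact: Wge.
  have n1' : (1 < n)%N by rewrite ltn_neqAle eq_sym n1.
  apply: (@le_trans _ _ b); last by rewrite lerDl mulr_ge0 // add0r addr0.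
  apply: (nonexceptional_error n1' ug0 _ _ lev1 lev2 Wle Ege).
    by move=> f fn ef; apply: nb; exists f.
  have cn := leq_trans (carmichael_le n1') nX.
  have := exp2_size_primes_le (carmichael_gt0 n1') => h2.
  have : (size (primes (carmichael n)) <= trunc_log 2 X)%N.
    by apply: trunc_log_max => //; apply: leq_trans h2 cn.
  rewrite -(ler_nat R) => /le_trans; apply; apply: le_trans (ln_nat_trunc_log R X0) _.
  by rewrite ler_pM2l ?ltr0n.
have yi : y^-1 <= expR (- (3 * u)).
  rewrite expRN lef_pV2 ?posrE ?expR_gt0 //; apply: le_trans (ltW hy).
  by rewrite ler_expR; clear -ug0; lra.
have yip : y^-1 <= p by apply: le_trans yi _; rewrite ler_expR; clear -ug0; lra.
have yhp : y^-1 * expR (u / 100) <= p.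
  apply: le_trans (ler_wpM2r (expR_ge0 _) yi) _.
  by rewrite -expRD ler_expR; clear -ug0; lra.
have Yy1 : y^-1 * Y%:R <= 1 by rewrite mulrC ler_pdivrMr // mul1r.
have yi0 : 0 <= y^-1 by rewrite invr_ge0 ltW.
rewrite Ncount_sum -/X -/Y mulr_sumr -sumrB.
apply: le_trans (ler_norm_sum _ _ _) _.
apply: (@le_trans _ _ (\sum_(1 <= n < X.+1) (5 * p +
    ((bad n)%:R + 2 ^+ size (primes n) * expR (- (u / 100)) + (n == 1)%:R)))).
  apply: ler_sum_nat => n /andP[n0 nX]; have := Dn n n0 nX.
  have [_ /andP[r0 r1]] := count_trivial R Y n0.
  rewrite -/(A n) -/(r n) in r0 r1 *.
  set z := (bad n)%:R + _ + _ => hD.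
  have z0 : 0 <= z by rewrite !addr_ge0 ?mulr_ge0 ?exprn_ge0 ?expR_ge0 ?ler0n.
  (* The second term is the price of dividing by y instead of its integer part, at most 1/y. *)
  have -> : y^-1 * A n - r n = y^-1 * (A n - Y%:R * r n) - r n * (1 - y^-1 * Y%:R) by ring.
  have h : y < Y%:R + 1 by rewrite natr1 truncnS_gt.
  have h1 : 1 - y^-1 * Y%:R <= y^-1.
    have e : y^-1 * y = 1 by rewrite mulVf // gt_eqF.
    by rewrite -{1}e -mulrBr -[leRHS]mulr1 ler_wpM2l // lerBlDl ltW.
  have h2 : 0 <= 1 - y^-1 * Y%:R by rewrite subr_ge0.
  apply: le_trans (ler_normB _ _) _.
  rewrite normrM (ger0_norm yi0) normrM (ger0_norm r0) (ger0_norm h2).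
  have t1 : r n * (1 - y^-1 * Y%:R) <= p.
    by apply: le_trans yip; rewrite -[leRHS]mul1r ler_pM.
  have t2 : y^-1 * `|A n - Y%:R * r n| <= 3 * p + p + z.
    have scale v : 0 <= v -> y^-1 * (Y%:R * v) <= v.
      by move=> v0; rewrite mulrA -[leRHS]mul1r ler_wpM2r.
    apply: le_trans (ler_wpM2l yi0 hD) _.
    rewrite mulrDr [X in X + _ <= _]mulrDr; apply: lerD; last exact: scale.
    by apply: lerD => //; apply: scale; rewrite mulr_ge0 ?ler0n ?(ltW p0).
  have fin (a b v w : R) : a <= v -> b <= 3 * v + v + w -> b + a <= 5 * v + w.
    by clear => *; lra.
  exact: fin t1 t2.
rewrite big_split /= big_split /= big_split /=.
have s1 : \sum_(1 <= n < X.+1) 5 * p <= 5 * (x * (q * p)).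
  rewrite big_const_nat iter_addr addr0 subSS subn0 -[leLHS]mulr_natl mulrCA ler_pM2l ?ltr0n //.
  by rewrite mulrC mulrC ler_pM ?(ltW p0) // -{1}[p]mul1r ler_pM2r.
have s2 : \sum_(1 <= n < X.+1) (n == 1)%:R <= x * (q * p).
  rewrite big_ltn // big_nat_cond big1 ?addr0; last first.
    by move=> [|[|n]] // /andP[].
  have xp : 1 <= x * p.
    rewrite xE -expRD -[leLHS]expR0 ler_expR subr_ge0.
    have h : u * 1 <= u * u by rewrite ler_wpM2l //; clear -u400; lra.
    by rewrite expr2; clear -h ug0; lra.
  by apply: le_trans xp _; rewrite ler_pM2l // -{1}[p]mul1r ler_pM2r.
have s3 : \sum_(1 <= n < X.+1) (bad n)%:R <= 4 * (x * (q * p)).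
  by apply: le_trans Nexc; rewrite [leRHS]big_mkcond; apply: ler_sum => n _; case: (bad n).
have qp : q * p <= (1 + 2 * c ^+ 2) * expR (- (c^-1 * u)).
  have -> : p = expR (- (u / c)) * expR (- (c^-1 * u)).
    by rewrite -expRD; congr expR; rewrite /c; clear; lra.
  by rewrite mulrA ler_wpM2r ?expR_ge0 // poly_expR_le.
have -> : 11 * (1 + 2 * c ^+ 2) * x * expR (- (c^-1 * u)) =
    11 * (x * ((1 + 2 * c ^+ 2) * expR (- (c^-1 * u)))) by ring.
apply: (@le_trans _ _ (11 * (x * (q * p)))); last by rewrite ler_pM2l ?ltr0n // ler_pM2l.
move: s1 s2 s3 Ndiv.
move: (\sum_(1 <= n < X.+1) _) (\sum_(1 <= n < X.+1) _) (\sum_(1 <= n < X.+1) _) (\sum_(1 <= n < X.+1) _).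
by move: (x * (q * p)); clear => *; lra.
Qed.
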